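(* Let $G$ be a $3$-connected partial $3$-tree, let $w\in V(G)$, and let $\{wu_i\}$ be a set of nonedges of $G$ all incident to $w$. If $G\cup wu_i$ is a partial $3$-tree for each $i$, then $G\cup\{wu_i\}_i$ is a partial $3$-tree.
   Context: A $3$-tree is either $K_4$ or a graph obtained from a $3$-tree by adding one new vertex adjacent to exactly the three vertices of some triangle of it. A partial $3$-tree is any subgraph of a $3$-tree. A graph $G$ is $3$-connected if it is connected and every set $U\subseteq V(G)$ with $G-U$ disconnected has at least $3$ vertices. A nonedge is a pair of distinct non-adjacent vertices; $G\cup F$ denotes $G$ with the pairs in $F$ added as edges. *)

(* Defs.v *)
From mathcomp Require Import all_boot.
Set Implicit Arguments. Unset Strict Implicit. Unset Printing Implicit Defensive.

Definition simple_graph (T : finType) (e : rel T) : Prop :=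
  symmetric e /\ irreflexive e.

(* 3-trees, as graphs with vertex set V : {set T} inside an ambient finType T
   and edge relation E (edges only between vertices of V). *)
Inductive three_tree (T : finType) : {set T} -> rel T -> Prop :=
  | three_tree_K4 (V : {set T}) (E : rel T) :
      #|V| = 4 ->
      (forall x y, E x y = [&& x \in V, y \in V & x != y]) ->
      three_tree V E
  | three_tree_add (V : {set T}) (E E' : rel T) (v a b c : T) :
      three_tree V E ->
      v \notin V ->
      a \in V -> b \in V -> c \in V ->
      E a b -> E b c -> E a c ->
      (forall x y, E' x y =
         [|| E x y, (x == v) && (y \in [set a; b; c])
                  | (y == v) && (x \in [set a; b; c])]) ->
      three_tree (v |: V) E'.

Definition partial_3tree (T : finType) (e : rel T) : Prop :=
  exists (T' : finType) (V : {set T'}) (E : rel T') (f : T -> T'),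
    [/\ three_tree V E, injective f, (forall x, f x \in V) &
        (forall x y, e x y -> E (f x) (f y))].

Definition connected_minus (T : finType) (e : rel T) (U : {set T}) : Prop :=
  forall x y, x \notin U -> y \notin U ->
    connect [rel a b | [&& e a b, a \notin U & b \notin U]] x y.

Definition connected (T : finType) (e : rel T) : Prop := connected_minus e set0.

Definition three_connected (T : finType) (e : rel T) : Prop :=
  connected e /\ (forall U : {set T}, ~ connected_minus e U -> 3 <= #|U|).

Definition add_edges_at (T : finType) (e : rel T) (w : T) (S : {set T}) : rel T :=
  [rel x y | [|| e x y, (x == w) && (y \in S) | (y == w) && (x \in S)]].

(* Main.v *)
Require Import Defs.
From mathcomp Require Import all_boot.
Set Implicit Arguments. Unset Strict Implicit. Unset Printing Implicit Defensive.

(** Partial 3-trees are the graphs with an elimination ordering of width at most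
    3.  Since [G + wu] satisfies the hypotheses again, it is enough to add two
    edges [wu], [wv] at once; this is done by induction on the number of
    vertices.  Take an ordering for [G + wu] that ends with [v], let [A] be the
    component of [w] among the vertices up to [w], and [X] its neighbourhood, so
    that [|X| <= 3].  If [v] is in [X], the same ordering admits [wv].
    Otherwise [X] separates [w] from [v], and every component [J] of [A - w] has
    exactly three neighbours, [w] and two vertices of [X].  If [J] can be
    contracted so as to make these three a triangle, replace [J] by that
    triangle and use the induction hypothesis.  If this is never possible, [A - w]
    consists of vertices of degree 3 with pairwise distinct independent
    neighbourhoods; since [w] has degree at least 3, the neighbours of [w] are
    exactly [A - w] and their neighbours are [w] and [X].  As [u] is in [X] and [v]
    is not, [u] has a common neighbour with [w] and [v] has none, which is absurd
    after exchanging [u] and [v]. *)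

(** * Elimination orderings of width at most 3 *)

Definition fill (T : finType) (x : T) (e : rel T) : rel T :=
  fun y z => e y z || (e y x && e x z).
Arguments fill T x e y z /.

(* An elimination ordering of width at most 3: when [x] is eliminated its
   neighbours in the rest of [s] are turned into a clique.  [fill] may create
   loops; they are never looked at. *)
Fixpoint eliminable (T : finType) (e : rel T) (s : seq T) : bool :=
  if s is x :: s' then
    (#|[set y in s' | e x y]| <= 3) && eliminable (fill x e) s'
  else true.

Lemma fill_sym (T : finType) (x : T) (e : rel T) :
  symmetric e -> symmetric (fill x e).
Proof. by move=> es y z; rewrite /= (es y z) (es y x) (es x z) andbC. Qed.

(** Fewer edges give less fill and hence smaller widths. Equal pairs are exempt because [fill] may
    create loops. *)
Lemma eliminable_mono (T : finType) (e e' : rel T) (s : seq T) :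
  uniq s -> {in s &, forall x y, x != y -> e x y -> e' x y} ->
  eliminable e' s -> eliminable e s.
Proof.
elim: s e e' => //= x s IH e e' /andP[xs us] sub /andP[c el].
have nx y : y \in s -> x != y by move=> ys; apply: contraNneq xs => ->.
apply/andP; split.
  apply: leq_trans c; apply/subset_leq_card/subsetP => y; rewrite !inE => /andP[ys exy].
  by rewrite ys sub ?inE ?eqxx ?ys ?orbT ?nx.
apply: IH el => // p q ps qs npq /= /orP[epq|/andP[epx exq]].
  by rewrite sub // inE ?ps ?qs orbT.
apply/orP; right; rewrite !sub ?inE ?eqxx ?ps ?qs ?orbT ?nx //.
by rewrite eq_sym nx.
Qed.

Lemma eliminable_small (T : finType) (e : rel T) (s : seq T) :
  size s <= 4 -> eliminable e s.
Proof.
elim: s e => //= x s IH e sz; apply/andP; split; last by apply: IH; apply: ltnW.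
rewrite -ltnS; apply: leq_trans sz; rewrite ltnS; apply: leq_trans (card_size s).
by apply/subset_leq_card/subsetP => y; rewrite inE => /andP[].
Qed.

(** * Connected sets, their neighbourhoods and components *)

(* Connectedness by cuts: no path has to be rerouted when a vertex is
   eliminated or a set contracted. *)
Definition conn (T : finType) (e : rel T) (J : {set T}) : Prop :=
  forall S : {set T}, S \subset J -> S != set0 -> S != J ->
    exists x y, [/\ x \in S, y \in J :\: S & e x y].

Definition nbr (T : finType) (e : rel T) (J : {set T}) : {set T} :=
  [set z | (z \notin J) && [exists y in J, e y z]].

Lemma nbrP (T : finType) (e : rel T) (J : {set T}) (z : T) :
  reflect (z \notin J /\ exists2 y, y \in J & e y z) (z \in nbr e J).
Proof.
rewrite inE; apply: (iffP andP) => -[zJ].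
  by case/exists_inP => y; split=> //; exists y.
by case=> y yJ eyz; split=> //; apply/exists_inP; exists y.
Qed.

Lemma nbr_mono (T : finType) (e f : rel T) (J : {set T}) :
  (forall x y, e x y -> f x y) -> nbr e J \subset nbr f J.
Proof.
move=> ef; apply/subsetP => z /nbrP[zJ [y yJ eyz]].
by apply/nbrP; split=> //; exists y => //; apply: ef.
Qed.

Lemma conn_mono (T : finType) (e f : rel T) (J : {set T}) :
  {in J &, forall x y, e x y -> f x y} -> conn e J -> conn f J.
Proof.
move=> ef cJ S SJ S0 SnJ; case: (cJ S) => // x [y [xS yS exy]].
exists x, y; split=> //; apply: ef => //; first exact: (subsetP SJ).
by case/setDP: yS.
Qed.

Lemma conn1 (T : finType) (e : rel T) (a : T) : conn e [set a].
Proof.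
move=> S; rewrite subset1 => /orP[/eqP->|/eqP->]; by rewrite eqxx.
Qed.

Lemma conn_out (T : finType) (e : rel T) (J : {set T}) (x : T) :
  conn e J -> x \in J -> J != [set x] -> exists2 y, y \in J :\ x & e x y.
Proof.
move=> cJ xJ nJ; case: (cJ [set x]).
- by rewrite sub1set.
- by apply/set0Pn; exists x; rewrite inE.
- by rewrite eq_sym.
- by move=> x' [y [/set1P-> yJ exy]]; exists y.
Qed.

(** Eliminating [x] joins its neighbours to each other, so a connection through [x] survives as a
    direct edge. *)
Lemma conn_fill (T : finType) (e : rel T) (J : {set T}) (x : T) :
  symmetric e -> conn e J -> x \in J -> conn (fill x e) (J :\ x).
Proof.
move=> es cJ xJ S SJ S0 SnJ.
have xS : x \notin S by apply/negP => /(subsetP SJ); rewrite !inE eqxx.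
have SJ' : S \subset J by apply: subset_trans SJ (subD1set _ _).
case: (cJ S) => //; first by apply: contraNneq xS => ->.
move=> p [q [pS /setDP[qJ qS] epq]].
have [qx|nqx] := eqVneq q x; last first.
  by exists p, q; rewrite !inE qS qJ nqx pS /= epq.
subst q.
(* The edge found ends in [x]. An edge leaving [x |: S] either continues it, giving a fill edge, or
   starts in [S] and serves by itself. *)
case: (cJ (x |: S)).
- by rewrite subUset sub1set xJ.
- by apply/set0Pn; exists x; rewrite !inE eqxx.
- apply: contraNneq SnJ => <-; apply/eqP/setP => z; rewrite !inE.
  by case: eqVneq => // ->; rewrite (negbTE xS).
move=> p' [q']; rewrite !inE negb_or => -[p'S /andP[/andP[q'x q'S] q'J] e'].
case/orP: p'S => [/eqP p'x|p'S].
  by subst p'; exists p, q'; rewrite !inE q'x q'S q'J pS /= epq e' orbT.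
by exists p', q'; rewrite !inE q'x q'S q'J p'S /= e'.
Qed.

(** The component of [x] in [B] is taken as a smallest closed set containing [x]. A part of it that
    contains [x] and is left by no edge would be a smaller closed set; a part without [x] is handled
    through its complement. *)
Lemma conn_min (T : finType) (e : rel T) (B : {set T}) (x : T) :
  symmetric e -> x \in B ->
  exists A : {set T}, [/\ A \subset B, x \in A, conn e A &
    forall p q, p \in A -> q \in B -> e p q -> q \in A].
Proof.
move=> es xB.
pose cl (A : {set T}) := [&& A \subset B, x \in A &
  [forall p in A, forall q in B, e p q ==> (q \in A)]].
have clB : cl B.
  by rewrite /cl subxx xB /=; apply/forall_inP => p _; apply/forall_inP => q ->; rewrite implybT.
case: (arg_minnP (fun A : {set T} => #|A|) clB) => A /and3P[AB xA /forall_inP clA] minA.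
have closed p q : p \in A -> q \in B -> e p q -> q \in A.
  by move=> pA qB; apply/implyP; move: q qB; apply/forall_inP/clA.
exists A; split=> //.
have key (S : {set T}) : S \subset A -> x \in S -> S != A -> exists p q, [/\ p \in S, q \in A :\: S & e p q].
  move=> SA xS SnA.
  have : ~~ cl S.
    apply/negP => /minA le; case/negP: SnA; by rewrite eqEcard SA le.
  rewrite /cl (subset_trans SA AB) xS /= negb_forall => /existsP[p].
  rewrite negb_imply => /andP[pS]; rewrite negb_forall => /existsP[q].
  rewrite !negb_imply => /and3P[qB epq qS]; exists p, q; split=> //.
  by rewrite inE qS (closed p) // (subsetP SA).
move=> S SA S0 SnA; have [xS|xS] := boolP (x \in S); first exact: key.
case: (key (A :\: S)); rewrite ?subsetDl // ?inE ?xS ?xA //.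
  apply: contraNneq S0 => eq; apply/eqP/setP => z; rewrite inE.
  apply/negP => zS; have := subsetP SA _ zS; by rewrite -eq inE zS.
move=> p [q [pA]]; rewrite inE => /andP[]; rewrite inE negb_and negbK => /orP[qS|/negbTE->//] qA epq.
by exists q, p; rewrite es.
Qed.

(** As [J'] is closed in [J - d], an edge leaving a set that avoids [d] cannot enter [J']. Sets
    containing [d] are replaced by their complements. *)
Lemma conn_setD (T : finType) (e : rel T) (J J' : {set T}) (d : T) :
  symmetric e -> conn e J -> d \in J -> d \notin J' ->
  (forall p q, p \in J' -> q \in J :\ d -> e p q -> q \in J') ->
  conn e (J :\: J').
Proof.
move=> es cJ dJ dJ' clJ'.
have key (S : {set T}) : S \subset J :\: J' -> S != set0 -> d \notin S ->
    exists p q, [/\ p \in S, q \in (J :\: J') :\: S & e p q].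
  move=> SR S0 dS; have SJ := subset_trans SR (subsetDl _ _).
  case: (cJ S) => //; first by apply: contraNneq dS => ->.
  move=> p [q [pS /setDP[qJ qS] epq]]; exists p, q; split=> //.
  rewrite !inE qS qJ andbT /=; apply/negP => qJ'.
  have pJ : p \in J :\ d.
    rewrite inE (subsetP SJ) // andbT inE; by apply: contraNneq dS => <-.
  have := clJ' q p qJ' pJ; rewrite es => /(_ epq) pJ'.
  by have := subsetP SR _ pS; rewrite inE pJ'.
move=> S SR S0 SnR; have [dS|dS] := boolP (d \in S); last exact: key.
case: (key ((J :\: J') :\: S)).
- exact: subsetDl.
- apply: contraNneq SnR => /eqP; rewrite setD_eq0 => RS; by rewrite eqEsubset SR.
- by rewrite inE dS.
move=> p [q [pR qq epq]]; exists q, p; rewrite es; split=> //.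
by move: qq; rewrite !inE; case: (q \in S) => //; rewrite andNb.
Qed.

Lemma conn_add (T : finType) (e : rel T) (D : {set T}) (a : T) :
  symmetric e -> conn e D -> a \in nbr e D -> conn e (a |: D).
Proof.
move=> es cD /nbrP[aD [y yD eya]].
have key (S : {set T}) : S \subset D -> S != set0 ->
    exists p q, [/\ p \in S, q \in (a |: D) :\: S & e p q].
  move=> SD S0; have [SeD|SnD] := eqVneq S D.
    by exists y, a; rewrite SeD !inE eqxx aD yD.
  case: (cD S) => // p [q [pS /setDP[qD qS] epq]].
  by exists p, q; rewrite !inE qS qD pS orbT.
move=> S SaD S0 SnaD; have [aS|aS] := boolP (a \in S); last first.
  apply: key => //; apply/subsetP => z zS; have := subsetP SaD _ zS.
  by rewrite !inE => /orP[/eqP za|//]; rewrite za (negbTE aS) in zS.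
case: (key ((a |: D) :\: S)).
- apply/subsetP => z; rewrite !inE => /andP[zS /orP[/eqP za|//]].
  by rewrite za aS in zS.
- apply: contraNneq SnaD => /eqP; rewrite setD_eq0 => RS; by rewrite eqEsubset SaD.
move=> p [q [pR qq epq]]; exists q, p; rewrite es; split=> //.
by move: qq; rewrite !inE; case: (q \in S) => //=; rewrite andNb.
Qed.

(** * Width bounds from connected sets *)

(** Here [x] is the last vertex of [J]. Each eliminated vertex of [J] hands its neighbours over to
    the rest of [J], so when [x] is reached it is adjacent to all the neighbours of [J] that
    remain. *)
Lemma eliminable_width (T : finType) (e : rel T) (s1 s2 : seq T) (x : T) (J : {set T}) :
  symmetric e -> uniq (s1 ++ x :: s2) -> eliminable e (s1 ++ x :: s2) ->
  conn e J -> x \in J -> {subset J <= x :: s1} ->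
  #|[set z in nbr e J | z \in s2]| <= 3.
Proof.
elim: s1 e J => [|y s1 IH] e J es /=.
  move=> _ /andP[c _] _ xJ Jx; apply: leq_trans c; apply/subset_leq_card/subsetP => z.
  rewrite !inE => /andP[/andP[zJ /exists_inP[p pJ epz]] zs2]; rewrite zs2.
  by have := Jx _ pJ; rewrite inE => /eqP <-.
case/andP=> yn us /andP[_ el] cJ xJ Jsub.
have yx : x != y by apply: contraNneq yn => <-; rewrite mem_cat mem_head orbT.
have ys2 : y \notin s2 by apply: contra yn => ys2; rewrite mem_cat inE ys2 !orbT.
have [yJ|yJ] := boolP (y \in J); last first.
  apply: leq_trans (IH _ J (fill_sym y es) us el _ xJ _).
  - apply/subset_leq_card/subsetP => z; rewrite !inE => /andP[/andP[-> /exists_inP[p pJ epz]] ->].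
    by rewrite andbT; apply/exists_inP; exists p => //=; rewrite epz.
  - by apply: conn_mono cJ => p q _ _ /= ->.
  - move=> z zJ; have := Jsub _ zJ; rewrite !inE => /or3P[->//|/eqP zy|->]; last by rewrite orbT.
    by rewrite -zy zJ in yJ.
apply: leq_trans (IH _ (J :\ y) (fill_sym y es) us el _ _ _).
- apply/subset_leq_card/subsetP => z.
  rewrite inE => /andP[/nbrP[zJ [p pJ epz]] zs2]; rewrite inE zs2 andbT.
  have zJy : z \notin J :\ y by rewrite inE negb_and zJ orbT.
  apply/nbrP; split=> //.
  have [py|npy] := eqVneq p y; last first.
    by exists p; rewrite ?inE ?npy //= epz.
  subst p; have [|q qJ eyq] := conn_out cJ yJ.
    by apply/eqP => Jy; move: xJ; rewrite Jy inE (negbTE yx).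
  by exists q => //=; rewrite [e q y]es eyq epz orbT.
- exact: conn_fill.
- by rewrite !inE yx.
- move=> z; rewrite !inE => /andP[zy /Jsub]; rewrite !inE (negbTE zy) /=; by [].
Qed.

(** Cutting [s] at the last vertex of [J] leaves [Z] entirely in the second piece, where
    [eliminable_width] applies. *)
Lemma width_later (T : finType) (e : rel T) (s : seq T) (J Z : {set T}) :
  symmetric e -> uniq s -> eliminable e s -> conn e J -> J != set0 ->
  {subset J <= s} -> {subset Z <= s} -> Z \subset nbr e J ->
  (forall j z, j \in J -> z \in Z -> index j s < index z s) -> #|Z| <= 3.
Proof.
move=> es us el cJ /set0Pn[x0 x0J] Js Zs ZN ord.
case: (arg_maxnP (fun j => index j s) x0J) => x xJ xmax.
have xs := Js _ xJ.
case/splitPr: {-1}s / xs (erefl s) => s1 s2 sE.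
rewrite sE in us el; have us' := us.
rewrite cat_uniq /= in us'; case/and3P: us' => us1 /norP[xs1 hs] /andP[xs2 us2].
have ix : index x s = size s1 by rewrite sE index_cat (negbTE xs1) /= eqxx addn0.
have is2 z : z \in s2 -> size s1 < index z s.
  move=> zs2; rewrite sE index_cat ifN; last by apply: contra hs => zs1; apply/hasP; exists z.
  rewrite /= ifN ?addnS ?ltnS ?leq_addr //; by apply: contraNneq xs2 => ->.
apply: leq_trans (eliminable_width es us el cJ xJ _).
  apply/subset_leq_card/subsetP => z zZ; rewrite inE (subsetP ZN) //=.
  have := ord _ _ xJ zZ; rewrite ix; have := Zs _ zZ; rewrite sE mem_cat inE.
  case/or3P=> [zs1|/eqP->|//]; last by rewrite index_cat (negbTE xs1) /= eqxx addn0 ltnn.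
  rewrite index_cat zs1 => h; have := ltn_trans h (_ : index z s1 < size s1).
  by rewrite index_mem zs1 ltnn => /(_ isT).
move=> j jJ; have := Js _ jJ; rewrite sE mem_cat !inE => /or3P[->|->//|js2]; first by rewrite orbT.
have := xmax j jJ; rewrite ix; have := is2 _ js2 => h1 h2.
by have := leq_ltn_trans h2 h1; rewrite ltnn.
Qed.

(** * Operations on orderings: minors, gluing, change of the last clique, a new edge *)

Definition some_fiber (T T' : finType) (h : T -> option T') (s : seq T) (p : T') : {set T} :=
  [set x in s | h x == Some p].

(* The partial map [h] sends each branch set of the minor to its vertex and
   deletes the rest.  [undup] keeps last occurrences, so a branch set is
   eliminated together with its last vertex. *)
Lemma eliminable_minor (T T' : finType) (e : rel T) (e' : rel T') (h : T -> option T') (s : seq T) :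
  symmetric e -> uniq s -> eliminable e s ->
  (forall p, conn e (some_fiber h s p)) ->
  {in pmap h s &, forall p q, p != q -> e' p q ->
     exists x y, [/\ x \in some_fiber h s p, y \in some_fiber h s q & e x y]} ->
  eliminable e' (undup (pmap h s)).
Proof.
elim: s e e' => //= x s IH e e' es /andP[xs us] /andP[c el] cf ed.
have fE p : some_fiber h s p = some_fiber h (x :: s) p :\ x.
  apply/setP => z; rewrite !inE; case: (eqVneq z x) => //= ->.
  by rewrite (negbTE xs).
have cf' p : conn (fill x e) (some_fiber h s p).
  have [xp|xp] := boolP (x \in some_fiber h (x :: s) p).
    by rewrite fE; apply: conn_fill.
  have -> : some_fiber h s p = some_fiber h (x :: s) p.
    rewrite fE; apply/setP => z; rewrite in_setD1.
    by case: (eqVneq z x) => // ->; rewrite (negbTE xp).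
  by apply: conn_mono (cf p) => a b _ _ /= ->.
have sub p z : z \in some_fiber h s p -> z \in some_fiber h (x :: s) p.
  by rewrite fE => /setD1P[].
case hx: (h x) => [p|] /=; last first.
  apply: IH (fill_sym x es) us el cf' _ => q r qs rs qr eqr.
  case: (ed q r) => [||||a [b [aq br eab]]]; rewrite ?hx //.
  have nx q' a' : a' \in some_fiber h (x :: s) q' -> a' != x.
    by rewrite !inE => /andP[_ /eqP hq]; apply/eqP => ax; rewrite ax hx in hq.
  exists a, b; rewrite !fE !in_setD1 aq br (nx _ _ aq) (nx _ _ br) /= eab; by [].
have other q a : a \in some_fiber h (x :: s) q -> q != p -> a \in some_fiber h s q.
  rewrite fE in_setD1 => aq qp; rewrite aq andbT; apply/eqP => ax.
  by move: aq; rewrite ax inE hx => /andP[_ /eqP[pq]]; rewrite pq eqxx in qp.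
have inS q a : a \in some_fiber h s q -> q \in pmap h s.
  by rewrite inE mem_pmap => /andP[as_ /eqP <-]; apply: map_f.
have xfp : x \in some_fiber h (x :: s) p by rewrite inE mem_head hx eqxx.
case: ifP => ps.
  apply: IH (fill_sym x es) us el cf' _ => q r qs rs qr eqr.
  have [a [b [aq br eab]]] : exists a b, [/\ a \in some_fiber h (x :: s) q, b \in some_fiber h (x :: s) r & e a b].
    by apply: ed => //; rewrite hx inE ?qs ?rs orbT.
  (* The branch set of [p] continues after [x], and [c1] is a vertex of it adjacent to [x]; the fill
     transfers the edges of [x] to [c1]. *)
  have [c1 c1p exc1] : exists2 y, y \in some_fiber h s p & e x y.
    rewrite fE; apply: conn_out => //.
    move: ps; rewrite mem_pmap => /mapP[y ys hy]; apply/eqP/setP => /(_ y).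
    rewrite !inE ys -hy eqxx orbT /= => /esym/eqP yx; by rewrite -yx ys in xs.
  have [qp|nqp] := eqVneq q p.
    subst q; have b' := other _ _ br; rewrite eq_sym in qr; have {}b' := b' qr.
    have [ax|nax] := eqVneq a x.
      by subst a; exists c1, b; rewrite /= [e c1 x]es exc1 eab orbT; split.
    by exists a, b; rewrite /= eab fE in_setD1 nax aq.
  have a' := other _ _ aq nqp.
  have [bx|nbx] := eqVneq b x.
    have rp : r = p by move: br; rewrite bx inE hx => /andP[_ /eqP[]].
    by subst b r; exists a, c1; rewrite /= exc1 eab orbT.
  exists a, b; rewrite /= eab; split=> //; by rewrite fE in_setD1 nbx.
(* Now no vertex of the branch set comes after [x], so it is [x] alone and eliminating [x] amounts
   to eliminating [p]. *)
have fx : some_fiber h (x :: s) p = [set x].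
  apply/setP => z; rewrite !inE; case: (eqVneq z x) => [->|_] /=; first by rewrite hx eqxx.
  apply/negP => /andP[zs /eqP hz]; case/negP: ps; rewrite mem_pmap -hz; exact: map_f.
have wit q : q \in pmap h s -> e' p q \/ e' q p -> exists2 y, y \in some_fiber h s q & e x y.
  move=> qs; have nqp : q != p by apply: contraFneq ps => <-.
  case=> epq.
    case: (ed p q) => [||||a [b [ap bq eab]]]; rewrite ?hx ?inE ?qs ?eqxx ?orbT // 1?eq_sym //.
    by exists b; [exact: other | move: ap; rewrite fx => /set1P <-].
  case: (ed q p) => [||||a [b [aq bp eab]]]; rewrite ?hx ?inE ?qs ?eqxx ?orbT //.
  by exists a; [exact: other | move: bp; rewrite fx => /set1P <-; rewrite es].
apply/andP; split.
  apply: leq_trans c.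
  (* Each neighbour of [p] is the image under [h] of a neighbour of [x], so there are at most as
     many. *)
  have : [set Some y | y in [set y in undup (pmap h s) | e' p y]] \subset
     h @: [set y in s | e x y].
    apply/subsetP => _ /imsetP[q + ->]; rewrite inE mem_undup => /andP[qs epq].
    have [y] := wit _ qs (or_introl epq); rewrite inE => /andP[ys /eqP hy] exy.
    by apply/imsetP; exists y; rewrite ?inE ?ys.
  move/subset_leq_card; rewrite card_imset; last by move=> ? ? [].
  move=> le; apply: leq_trans le (leq_imset_card _ _).
apply: IH (fill_sym x es) us el cf' _ => q r qs rs qr /= /orP[eqr|/andP[eqp epr]].
  have [a [b [aq br eab]]] : exists a b, [/\ a \in some_fiber h (x :: s) q, b \in some_fiber h (x :: s) r & e a b].
    by apply: ed => //; rewrite hx inE ?qs ?rs orbT.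
  by exists a, b; rewrite eab; split=> //; apply: other => //; apply: contraFneq ps => <-.
have [a aq exa] := wit _ qs (or_intror eqp).
have [b br exb] := wit _ rs (or_introl epr).
by exists a, b; rewrite [e a x]es exa exb orbT.
Qed.

(* Eliminating [J] first is possible because the fill it creates outside [J]
   stays inside [Y], which is a clique of [e']. *)
Lemma eliminable_glue (T : finType) (e g e' : rel T) (J Y : {set T}) (s s' : seq T) :
  symmetric g -> uniq s -> uniq s' -> eliminable e s -> eliminable e' s' ->
  {in s', forall x, x \notin J} ->
  {in s, forall j, j \in J -> {in Y, forall y, (y \in s) && (index j s < index y s)}} ->
  (forall x y, x \in s -> x \in J -> y \in s ++ s' -> x != y -> g x y ->
     e x y /\ y \in J :|: Y) ->
  {in s' &, forall x y, x != y -> g x y -> e' x y} ->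
  {in Y &, forall x y, x \in s' -> y \in s' -> x != y -> e' x y} ->
  eliminable g ([seq x <- s | x \in J] ++ s').
Proof.
elim: s e g => [|x s IH] e g gs /= us us' el el' nJ ord ge sub cY.
  exact: eliminable_mono el'.
case/andP: us => xs us; case/andP: el => c el.
have ord' : {in s, forall j, j \in J -> {in Y, forall y, (y \in s) && (index j s < index y s)}}.
  move=> j js jJ y yY; have := ord j; rewrite inE js orbT => /(_ isT jJ y yY).
  have jx : x != j by apply: contraNneq xs => ->.
  rewrite inE /= (negbTE jx) (eq_sym y); by case: (eqVneq x y).
(* A vertex outside [J] is eliminated on the side of [e] only, which just adds edges to [e]. *)
have [xJ|xJ] := boolP (x \in J); last first.
  apply: (IH (fill x e)) => // y z ys yJ zs yz gyz.
  by case: (ge y z) => [|||||eyz ->]; rewrite ?inE ?ys ?zs /= ?eyz ?orbT.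
have xs' : x \notin s' by apply/negP => /nJ; rewrite xJ.
have Ys : {subset Y <= s}.
  move=> y yY; have := ord x (mem_head _ _) xJ y yY; rewrite inE /= eqxx (eq_sym y).
  by case: (eqVneq x y) => //= _; case/andP.
have gex y : y \in s ++ s' -> g x y -> e x y /\ y \in J :|: Y.
  move=> ys; apply: ge; rewrite ?mem_head // ?inE ?ys ?orbT //.
  apply: contraTneq ys => <-; by rewrite mem_cat negb_or xs xs'.
rewrite /=; apply/andP; split.
  (* A neighbour of [x] in [s'] lies in [Y], hence in [s], so it is already counted in the width of
     [e] at [x]. *)
  apply: leq_trans c; apply/subset_leq_card/subsetP => y; rewrite !inE mem_cat mem_filter.
  case/andP=> ys gxy; have {}ys : (y \in s) || (y \in s') && (y \notin s).
    by case: (y \in s) ys; rewrite ?orbT //= andbF /= andbT.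
  have ys2 : y \in s ++ s' by rewrite mem_cat; case/orP: ys => [->//|/andP[->]]; rewrite orbT.
  case: (gex y ys2 gxy) => -> yJY; rewrite andbT.
  case/orP: ys => // /andP[ys' _]; move: yJY; rewrite inE (negbTE (nJ _ ys')) /=; exact: Ys.
apply: (IH (fill x e)) => //.
- exact: fill_sym.
- move=> y z ys yJ zs yz /= /orP[gyz|/andP[gyx gxz]].
    by case: (ge y z) => [|||||eyz ->]; rewrite ?inE ?ys ?zs ?eyz ?orbT.
  have [exz zJY] := gex _ zs gxz; split=> //; rewrite exz.
  case: (ge y x) => [|||||-> _]; rewrite ?inE ?ys ?eqxx /= ?orbT //.
  by apply: contraNneq xs => <-.
- move=> y z ys zs yz /= /orP[|/andP[gyx gxz]]; first exact: sub.
  rewrite gs in gyx.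
  have Y' w : w \in s' -> g x w -> w \in Y.
    move=> ws gxw; case: (gex w) => //; first by rewrite mem_cat ws orbT.
    by rewrite inE (negbTE (nJ _ ws)).
  by apply: cY => //; apply: Y'.
Qed.

(* When [x] in [Q] is eliminated first, its neighbourhood is a clique which by
   induction can be eliminated last; [x] then joins it, and at most four
   vertices are eliminated last, in any order. *)
Lemma eliminable_reroot (T : finType) (e : rel T) (s : seq T) (Q : {set T}) :
  symmetric e -> uniq s -> eliminable e s -> {subset Q <= s} ->
  {in Q &, forall x y, x != y -> e x y} ->
  exists s0 q, [/\ uniq (s0 ++ q), s0 ++ q =i s, q =i Q & eliminable e (s0 ++ q)].
Proof.
elim: s e Q => [|x s IH] e Q es /=.
  move=> _ _ Qs _; exists [::], [::]; split=> // z; rewrite in_nil.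
  by apply/esym/negP => /Qs.
case/andP=> xs us /andP[c el] Qs cQ.
have [xQ|xQ] := boolP (x \in Q); last first.
  have [|p q pQ qQ pq|s0 [q [u0 i0 iq el0]]] := IH _ Q (fill_sym x es) us el.
  - by move=> z zQ; have := Qs _ zQ; rewrite inE => /orP[/eqP zx|//]; rewrite -zx zQ in xQ.
  - by rewrite /= cQ.
  exists (x :: s0), q; split=> //=.
  - by rewrite i0 xs.
  - by move=> z; rewrite !inE i0.
  rewrite el0 andbT; apply: leq_trans c; apply/subset_leq_card/subsetP => z.
  by rewrite !inE i0.
pose X := [set y in s | e x y].
have [z|p q|s0 [q [u0 i0 iq el0]]] := IH _ X (fill_sym x es) us el.
- by rewrite inE => /andP[].
- by rewrite !inE => /andP[_ exp] /andP[_ exq] _ /=; rewrite [e p x]es exp exq orbT.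
(* The at most four vertices of [x |: X] go last, those of [Q] at the very end. *)
pose r2 := enum Q; pose r1 := enum ((x |: X) :\: Q).
have QX : Q \subset x |: X.
  apply/subsetP => z zQ; rewrite !inE; case: eqVneq => //= zx.
  by have := Qs _ zQ; rewrite inE (negbTE zx) /= => ->; rewrite cQ // eq_sym.
have ur : uniq (r1 ++ r2).
  rewrite cat_uniq !enum_uniq andbT /=; apply/hasPn => z; rewrite mem_enum => zQ.
  by rewrite mem_enum !inE zQ.
have rE : r1 ++ r2 =i x |: X.
  move=> z; rewrite mem_cat !mem_enum in_setD.
  by case: (boolP (z \in Q)) => [/(subsetP QX)->|]; rewrite ?orbT ?orbF.
have us0 := u0; rewrite cat_uniq in us0; case/and3P: us0 => us0 /hasPn s0q uq.
have s0X z : z \in s0 -> z \notin X.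
  by move=> zs; rewrite -iq; apply/negP => /s0q; rewrite /= zs.
have xs0 : x \notin s0.
  by apply: contra xs => xs0; rewrite -i0 mem_cat xs0.
have s0r z : z \in s0 -> z \notin r1 ++ r2.
  move=> zs; rewrite rE in_setU1 negb_or (s0X z zs) andbT.
  by apply: contraNneq xs0 => <-.
exists (s0 ++ r1), r2; rewrite -catA; split.
- rewrite cat_uniq us0 ur andbT /=; apply/hasPn => z zr; apply/negP => /s0r; by rewrite zr.
- by move=> z; rewrite mem_cat rE in_setU1 -iq inE -i0 mem_cat orbCA.
- by move=> z; rewrite mem_enum.
(* This presents [s0] in the form that [eliminable_glue] expects. The complete relation can serve as
   its [e'], since at most four vertices follow. *)
have fE : [seq z <- s0 ++ q | z \in [set z in s0]] = s0.
  rewrite filter_cat; set a := filter _ _; set b := filter _ _.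
  have -> : b = [::].
    rewrite -(filter_pred0 q); apply: eq_in_filter => z zq /=; rewrite inE; exact/negbTE/s0q.
  by rewrite cats0 /a; apply/all_filterP/allP => z; rewrite inE.
rewrite -fE; apply: (@eliminable_glue _ (fill x e) e (fun _ _ => true) [set z in s0] X (s0 ++ q)) => //.
- apply: eliminable_small; rewrite -(card_uniqP ur) (eq_card rE).
  apply: leq_trans (leq_card_setU _ _) _; by rewrite cards1.
- by move=> z zr; rewrite inE; apply/negP => /s0r; rewrite zr.
- move=> j js; rewrite inE => js0 y yX.
  have ynot : y \notin s0 by apply/negP => /s0X; rewrite yX.
  rewrite mem_cat iq yX orbT /= !index_cat js0 (negbTE ynot).
  by rewrite ltn_addr // index_mem.
move=> y z _; rewrite inE => ys; rewrite mem_cat rE -/X => zs yz eyz; split; first by rewrite /= eyz.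
rewrite !inE; case/orP: zs.
  by rewrite mem_cat iq inE => /orP[->|->]; rewrite ?orbT.
rewrite !inE => /orP[/eqP zx|->]; last by rewrite orbT.
have ynX := s0X _ ys; rewrite inE in ynX; case/negP: ynX; rewrite es -zx eyz andbT.
by rewrite -i0 mem_cat ys.
Qed.

(** By the time [w] is reached, the fill through [J] has made [v] adjacent to [w]. Before that
    neither end is eliminated, so the edge [wv] raises no width. *)
Lemma eliminable_add_edge (T : finType) (e : rel T) (s1 s2 : seq T) (w v : T) (J : {set T}) :
  symmetric e -> uniq (s1 ++ w :: s2) -> eliminable e (s1 ++ w :: s2) ->
  conn e J -> w \in J -> {subset J <= w :: s1} -> v \in s2 -> v \in nbr e J ->
  eliminable (add_edges_at e w [set v]) (s1 ++ w :: s2).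
Proof.
elim: s1 e J => [|x s1 IH] e J es us el cJ wJ Js vs vJ.
  apply: eliminable_mono el => // p q _ _ pq; rewrite /add_edges_at /= !inE.
  have ewv : e w v.
    by case/nbrP: vJ => _ [y yJ eyv]; have := Js _ yJ; rewrite mem_seq1 => /eqP <-.
  by case/or3P=> [//|/andP[/eqP-> /eqP->]//|/andP[/eqP-> /eqP->]]; rewrite es.
move: us el => /= /andP[xs us] /andP[c el].
have xw : w != x by apply: contraNneq xs => <-; rewrite mem_cat mem_head orbT.
have xv : v != x by apply: contraNneq xs => <-; rewrite mem_cat inE vs !orbT.
apply/andP; split.
  apply: leq_trans c; apply/subset_leq_card/subsetP => z; rewrite !inE /add_edges_at /= !inE.
  by rewrite ![x == _]eq_sym (negbTE xw) (negbTE xv) /= andbF !orbF.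
have : eliminable (add_edges_at (fill x e) w [set v]) (s1 ++ w :: s2).
  have [xJ|xJ] := boolP (x \in J).
    apply: (IH _ (J :\ x)) => //.
    - exact: fill_sym.
    - exact: conn_fill.
    - by rewrite !inE xw.
    - move=> z /setD1P[zx /Js]; by rewrite !inE (negbTE zx).
    case/nbrP: vJ => vJ [y yJ eyv]; apply/nbrP; split; first by rewrite inE negb_and vJ orbT.
    have [yx|yx] := eqVneq y x; last by exists y; rewrite ?inE ?yx //= eyv.
    subst y; have [|q qJ exq] := conn_out cJ xJ.
      by apply/eqP => Jx; move: wJ; rewrite Jx inE (negbTE xw).
    by exists q => //=; rewrite [e q x]es exq eyv orbT.
  apply: (IH _ J) => //.
  - exact: fill_sym.
  - by apply: conn_mono cJ => p q _ _ /= ->.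
  - move=> z zJ; have := Js _ zJ; rewrite !inE => /or3P[->//|/eqP zx|->]; last by rewrite orbT.
    by rewrite -zx zJ in xJ.
  by apply: (subsetP _ _ vJ); apply: nbr_mono => p q /= ->.
apply: eliminable_mono => // p q _ _ pq; rewrite /add_edges_at /= !inE.
rewrite ![x == _]eq_sym (negbTE xw) (negbTE xv) /= !andbF !orbF.
case/orP=> [/or3P[->|->|->]|->]; by rewrite ?orbT.
Qed.

(** * Treewidth at most 3 and contractions *)

Definition tw3 (T : finType) (V : {set T}) (e : rel T) : Prop :=
  exists s, [/\ uniq s, s =i V & eliminable e s].

Lemma tw3_mono (T : finType) (V : {set T}) (e f : rel T) :
  {in V &, forall x y, x != y -> e x y -> f x y} -> tw3 V f -> tw3 V e.
Proof.
move=> ef [s [us sV el]]; exists s; split=> //.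
by apply: eliminable_mono el => // x y; rewrite !sV; apply: ef.
Qed.

(** Only the edges gained by [a] are recorded; the vertices of [D] are removed from the vertex set
    instead. *)
Definition contract (T : finType) (D : {set T}) (a : T) (e : rel T) : rel T :=
  fun p q => [|| e p q, (p == a) && (q \in nbr e D) | (q == a) && (p \in nbr e D)].
Arguments contract T D a e p q /.

Lemma contract_sym (T : finType) (D : {set T}) (a : T) (e : rel T) :
  symmetric e -> symmetric (contract D a e).
Proof. by move=> es p q; rewrite /= (es p q); congr (_ || _); rewrite orbC. Qed.

(** This is [eliminable_minor] with branch set [a |: D] at [a] and singletons elsewhere. *)
Lemma tw3_contract (T : finType) (V D : {set T}) (a : T) (e : rel T) :
  symmetric e -> a \in V -> D \subset V -> a \notin D -> conn e (a |: D) ->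
  tw3 V e -> tw3 (V :\: D) (contract D a e).
Proof.
move=> es aV DV aD cD [s [us sV el]].
pose h z := Some (if z \in D then a else z).
have hE p : (p \in pmap h s) = (p \in V :\: D).
  rewrite mem_pmap in_setD -sV; apply/mapP/andP => [[z zs [->]]|[pD ps]].
    by case: ifP => [_|/negbT //]; rewrite sV.
  by exists p; rewrite // /h (negbTE pD).
have fin z p : z \in V -> (if z \in D then a else z) = p -> z \in some_fiber h s p.
  by move=> zV zp; rewrite inE sV zV /h zp eqxx.
have faD : some_fiber h s a = a |: D.
  apply/setP => z; rewrite inE sV /h in_setU1.
  case: ifP => [zD|zD]; first by rewrite (subsetP DV _ zD) eqxx orbT.
  rewrite orbF; apply/andP/eqP => [[_ /eqP[]]//|->]; by rewrite aV eqxx.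
exists (undup (pmap h s)); split; rewrite ?undup_uniq //.
  by move=> p; rewrite mem_undup hE.
apply: eliminable_minor us el _ _ => // [p|p q].
  have [->|pa] := eqVneq p a; first by rewrite faD.
  have sub1 : some_fiber h s p \subset [set p].
    apply/subsetP => z; rewrite !inE /h => /andP[_]; case: ifP => _ /eqP[]; last by move->.
    by move=> ap; rewrite ap eqxx in pa.
  by move: sub1; rewrite subset1 => /orP[/eqP->|/eqP->]; [exact: conn1 | move=> S; rewrite subset0 => /eqP->; rewrite eqxx].
rewrite !hE !in_setD => /andP[pD pV] /andP[qD qV] pq.
have self z : z \in V -> z \notin D -> z \in some_fiber h s z.
  by move=> zV zD; apply: fin; rewrite ?(negbTE zD).
have inD z : z \in D -> z \in some_fiber h s a.
  by move=> zD; apply: fin; rewrite ?zD ?(subsetP DV).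
case/or3P=> [epq|/andP[/eqP pa /nbrP[_ [y yD eyq]]]|/andP[/eqP qa /nbrP[_ [y yD eyp]]]].
- by exists p, q; rewrite epq !self.
- by exists y, q; rewrite eyq self // pa inD.
- by exists p, y; rewrite es eyp self // qa inD.
Qed.

(** * Replacing a set by a clique on its boundary *)

Definition add_clique (T : finType) (Y : {set T}) (e : rel T) : rel T :=
  fun x y => e x y || (x \in Y) && (y \in Y).
Arguments add_clique T Y e x y /.

Lemma add_clique_sym (T : finType) (Y : {set T}) (e : rel T) :
  symmetric e -> symmetric (add_clique Y e).
Proof. by move=> es x y; rewrite /= es [(x \in Y) && _]andbC. Qed.

(** All supergraphs [f] of [e] are allowed because one and the same [J] has to be replaced both in
    [e] with [wu] and in [e] with [wv]. *)
Definition completes (T : finType) (V : {set T}) (e : rel T) (J Y : {set T}) : Prop :=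
  forall f : rel T, symmetric f -> (forall x y, e x y -> f x y) ->
    tw3 V f -> tw3 (V :\: J) (add_clique Y f).

Lemma clique3 (T : finType) (g : rel T) (a b c : T) : symmetric g ->
  g a b -> g a c -> g b c ->
  {in [set a; b; c] &, forall p q, p != q -> g p q}.
Proof.
move=> gs ab ac bc p q; rewrite !inE.
case/orP=> [/orP[]|] /eqP-> /orP[/orP[]|] /eqP->; rewrite ?eqxx // => _; by rewrite gs.
Qed.

Lemma cards3_set (T : finType) (K : {set T}) : #|K| = 3 ->
  exists a b c, [/\ K = [set a; b; c], a != b, b != c & a != c].
Proof.
move=> K3; have /card_gt2P[a [b [c [[aK bK cK] [ab bc ca]]]]] : 2 < #|K| by rewrite K3.
exists a, b, c; rewrite [a == c]eq_sym; split=> //; apply/esym/eqP; rewrite eqEcard K3; apply/andP; split.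
  by apply/subsetP => z /setUP[/set2P[]|/set1P] ->.
by rewrite setUC cardsU1 cards2 ab !inE negb_or ca eq_sym bc.
Qed.

(** Contract [D1] into [a] and [D2] into [c]. The edge [ab] comes from [D1], the edge [bc] from
    [D2], and [ac] from [D1] directly or through a vertex [r] of [D2] that [D1] sees. *)
Lemma completes_two (T : finType) (V D1 D2 : {set T}) (e : rel T) (a b c : T) :
  D1 \subset V -> D2 \subset V -> [disjoint D1 & D2] ->
  conn e D1 -> conn e D2 -> a != c ->
  a \in V :\: D2 -> b \in V -> c \in V :\: D1 ->
  a \in nbr e D1 -> b \in nbr e D1 -> b \in nbr e D2 -> c \in nbr e D2 ->
  (c \in nbr e D1) || [exists r in D2, r \in nbr e D1] ->
  completes V e (D1 :|: D2) [set a; b; c].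
Proof.
move=> D1V D2V dis c1 c2 nac /setDP[aV aD2] bV /setDP[cV cD1] a1 b1 b2 c2' ac f fs ef tw.
have sub D : {subset nbr e D <= nbr f D} by apply/subsetP/nbr_mono.
have {}a1 := sub _ _ a1; have {}b1 := sub _ _ b1; have {}b2 := sub _ _ b2; have {}c2' := sub _ _ c2'.
pose g1 := contract D1 a f; pose g2 := contract D2 c g1.
have g1s : symmetric g1 by apply: contract_sym.
have g2s : symmetric g2 by apply: contract_sym.
have fg1 x y : f x y -> g1 x y by rewrite /g1 /= => ->.
have g12 x y : g1 x y -> g2 x y by rewrite /g2 /= => ->.
have sub1 D : {subset nbr f D <= nbr g1 D} by apply/subsetP/nbr_mono.
have tw1 : tw3 (V :\: D1) g1.
  apply: tw3_contract => //; first by case/nbrP: a1.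
  by apply: conn_add => //; apply: conn_mono c1 => x y _ _; apply: ef.
have tw2 : tw3 ((V :\: D1) :\: D2) g2.
  apply: tw3_contract => //; first by rewrite inE cD1.
  - rewrite subsetD D2V; by rewrite disjoint_sym.
  - by case/nbrP: c2'.
  apply: conn_add => //; last exact: sub1.
  by apply: conn_mono c2 => x y _ _ exy; apply/fg1/ef.
rewrite -setDDl; apply: tw3_mono tw2 => p q _ _ pq /= /orP[fpq|/andP[pY qY]].
  by apply/g12/fg1.
move: p q pY qY pq; apply: clique3 => //.
- by apply: g12; rewrite /g1 /= eqxx b1 !orbT.
- case/orP: ac => [c1'|/exists_inP[r rD2 rD1]].
    by apply: g12; rewrite /g1 /= eqxx (sub _ _ c1') !orbT.
  rewrite /g2 /=; apply/or3P/Or33; rewrite eqxx /=; apply/nbrP; split=> //.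
  by exists r => //; rewrite /g1 /= eqxx (sub _ _ rD1) !orbT.
- by rewrite /g2 /= eqxx (sub1 _ _ b2) !orbT.
Qed.

(** Once [J] has become the triangle on [d], [a], [b], contracting [d] into [c] makes [a] and [b]
    adjacent to [c], and [ab] is present already. *)
Lemma completes_trans (T : finType) (V J : {set T}) (e : rel T) (a b c d : T) :
  symmetric e -> J \subset V -> d \in V -> d \notin J -> c \in V -> c \notin J -> c != d ->
  a != d -> b != d ->
  e d c -> completes V e J [set d; a; b] -> completes V e (d |: J) [set a; b; c].
Proof.
move=> es JV dV dJ cV cJ cd ad bd edc cmp f fs ef /(cmp f fs ef).
set g := add_clique _ f => tw.
have gs : symmetric g by apply: add_clique_sym.
have {tw} := tw3_contract (a := c) (D := [set d]) gs _ _ _ _ tw.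
have cnd : c \in nbr g [set d].
  by apply/nbrP; rewrite inE cd; split=> //; exists d; rewrite ?set11 // /g /= ef.
have gdn y : y \in [set a; b] -> y \in nbr g [set d].
  rewrite in_set2 => yab; apply/nbrP; split; first by rewrite inE; case/orP: yab => /eqP->.
  by exists d; rewrite ?set11 // /g /= !inE; case/orP: yab => /eqP->; rewrite !eqxx !orbT.
case=> [||||s [us sV el]].
- by rewrite inE cJ.
- by rewrite sub1set inE dJ.
- by rewrite inE.
- by apply: conn_add => //; apply: conn1.
exists s; split=> //; first by move=> z; rewrite sV !inE negb_or andbA.
apply: eliminable_mono el => // p q _ _ pq /= /orP[fpq|/andP[pY qY]].
  by rewrite /g /= fpq.
have := @clique3 _ (contract [set d] c g) a b c (contract_sym _ _ gs); apply => //.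
- by rewrite /g /= !inE !eqxx !orbT.
- by rewrite /= eqxx (gdn a) ?orbT // !inE eqxx.
- by rewrite /= eqxx (gdn b) ?orbT // !inE eqxx orbT.
Qed.

(** * 3-connectivity and rooted triangles *)

(* 3-connectivity of the graph induced on [V], separators being written as
   neighbourhoods; [v] witnesses that something lies on the other side. *)
Definition sep3 (T : finType) (V : {set T}) (e : rel T) : Prop :=
  forall (A : {set T}) (v : T), A \subset V -> A != set0 -> v \in V -> v \notin A -> v \notin nbr e A ->
    3 <= #|V :&: nbr e A|.

Lemma sep3_mono (T : finType) (V : {set T}) (e f : rel T) :
  (forall x y, e x y -> f x y) -> sep3 V e -> sep3 V f.
Proof.
move=> ef sp A v AV A0 vV vA vN; apply: leq_trans (sp A v AV A0 vV vA _) _.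
  by apply: contra vN; apply/subsetP/nbr_mono.
by apply/subset_leq_card/setIS/nbr_mono.
Qed.

(** If [A] misses the boundary of [J], its old neighbours all survive. If it meets the boundary, the
    clique makes the whole boundary visible from [A], so every old neighbour of [A :|: J] is a new
    neighbour of [A]. *)
Lemma sep3_reduce (T : finType) (V J : {set T}) (e : rel T) :
  symmetric e -> J \subset V -> sep3 V e ->
  sep3 (V :\: J) (add_clique (V :&: nbr e J) e).
Proof.
move=> es JV sp A v /subsetDP[AV dAJ] A0 /setDP[vV vJ] vA vN.
set Y := V :&: nbr e J in vN *; set g := add_clique Y e in vN *.
have eg x y : e x y -> g x y by rewrite /g /= => ->.
have AJ z : z \in A -> z \notin J by move=> zA; rewrite (disjointFr dAJ zA).
have NA z : z \in nbr e A -> z \in nbr g A by apply/subsetP/nbr_mono.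
have [AY|[y0 /setIP[y0A y0Y]]] := set_0Vmem (A :&: Y).
  apply: leq_trans (sp A v AV A0 vV vA _) _; first by apply: contra vN; apply: NA.
  apply/subset_leq_card/subsetP => z /setIP[zV zN]; rewrite !in_setI in_setD zV NA // !andbT.
  apply/negP => zJ; case/nbrP: zN => zA [y yA eyz].
  have : y \in A :&: Y.
    rewrite !in_setI yA (subsetP AV) //=; apply/nbrP; split; first exact: AJ.
    by exists z; rewrite // es.
  by rewrite AY inE.
have key z : z \in V -> z \in nbr e (A :|: J) -> z \in nbr g A.
  move=> zV /nbrP[]; rewrite in_setU negb_or => /andP[zA zJ] [y + eyz].
  rewrite in_setU => /orP[yA|yJ]; first by apply/NA/nbrP; split=> //; exists y.
  apply/nbrP; split=> //; exists y0 => //; rewrite /g /= y0Y /Y in_setI zV.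
  by apply/orP; right; apply/nbrP; split=> //; exists y.
apply: leq_trans (sp (A :|: J) v _ _ vV _ _) _.
- by rewrite subUset AV.
- by apply/set0Pn; exists y0; rewrite inE y0A.
- by rewrite inE negb_or vA.
- by apply: contra vN; apply: key.
apply/subset_leq_card/subsetP => z /setIP[zV zN]; rewrite !in_setI in_setD zV key // !andbT.
by case/nbrP: zN; rewrite inE negb_or => /andP[].
Qed.

(** Contracting [l] into [c] supplies [ac] and [bc]; the edge [ab] is given. *)
Lemma completes_leaf (T : finType) (V : {set T}) (e : rel T) (l a b c : T) :
  symmetric e -> l \in V -> c \in V -> c != l -> a != l -> b != l ->
  e l a -> e l b -> e l c -> e a b -> completes V e [set l] [set a; b; c].
Proof.
move=> es lV cV cl al bl la lb lc ab f fs ef tw.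
have n y : y != l -> e l y -> y \in nbr f [set l].
  by move=> yl ely; apply/nbrP; rewrite inE; split=> //; exists l; rewrite ?set11 ?ef.
have := tw3_contract (a := c) (D := [set l]) fs cV _ _ _ tw.
rewrite sub1set inE => /(_ lV cl) []; first by apply: conn_add (n c _ _) => //; apply: conn1.
move=> s [us sV el]; exists s; split=> //.
apply: eliminable_mono el => // p q _ _ pq /orP[fpq|/andP[pY qY]]; first by rewrite /= fpq.
have := @clique3 _ (contract [set l] c f) a b c (contract_sym _ _ fs); apply => //.
- by rewrite /= ef.
- by rewrite /= eqxx (n a) // !orbT.
- by rewrite /= eqxx (n b) // !orbT.
Qed.

(* With [d] the last vertex of [J] and [J'] a component of [J - d], the set [J']
   sees [d] and two vertices [a, b] of the boundary.  Contracting [J'] into one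
   of [a, b] and the rest of [J] into the third vertex [c] works unless the rest
   is [d] alone, attached to [c] only; then [J'] is treated recursively and [d]
   is contracted into [c]. *)
Lemma rooted_triangle (T : finType) (V : {set T}) (e : rel T) (s : seq T) :
  symmetric e -> sep3 V e -> uniq s -> s =i V -> eliminable e s ->
  forall (J : {set T}) (v : T), J \subset V -> J != set0 -> conn e J ->
    #|V :&: nbr e J| = 3 -> v \in V -> v \notin J -> v \notin nbr e J ->
    (forall j y, j \in J -> y \in V :&: nbr e J -> index j s < index y s) ->
    (exists l, J = [set l]) \/ completes V e J (V :&: nbr e J).
Proof.
move=> es sp us sV el J; have [n] := ubnP #|J|.
elim: n J => // n IH J; rewrite ltnS => Jn v JV /set0Pn[x0 x0J] cJ.
set Y := V :&: nbr e J => Y3 vV vJ vN ord.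
have vY : v \notin Y by rewrite inE negb_and vN orbT.
case: (arg_maxnP (fun j => index j s) x0J) => d dJ0 dmax0.
have dJ : d \in J by [].
have {dJ0} dmax j : j \in J -> index j s <= index d s by apply: dmax0.
have [Jd|Jd] := eqVneq J [set d]; first by left; exists d.
right; have [x xJd _] := conn_out cJ dJ Jd.
have [J' [J'Jd xJ' cJ' clJ']] := conn_min es xJd.
have J'J : J' \subset J by apply: subset_trans J'Jd (subD1set _ _).
have dJ' : d \notin J' by apply/negP => /(subsetP J'Jd); rewrite !inE eqxx.
have sepv (K : {set T}) : K \subset J -> K != set0 -> v \notin nbr e K -> 2 < #|V :&: nbr e K|.
  move=> KJ K0 vK; apply: (sp K v) => //; first exact: subset_trans JV.
  by apply: contra vJ; apply: (subsetP KJ).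
have nJ z p : z \in V -> p \in J -> e p z -> z \notin J -> z \in Y.
  by move=> zV pJ epz zJ; rewrite inE zV; apply/nbrP; split=> //; exists p.
pose N' := V :&: nbr e J'.
have N'sub : N' \subset d |: Y.
  apply/subsetP => z; rewrite in_setU1 => /setIP[zV /nbrP[zJ' [p pJ' epz]]].
  have [//|zd] := eqVneq z d; have [zJ|zJ] := boolP (z \in J).
    by case/negP: zJ'; apply: clJ' epz; rewrite // !inE zd.
  by rewrite (nJ z p) ?orbT // (subsetP J'J).
have ord' j z : j \in J' -> z \in N' -> index j s < index z s.
  move=> jJ' /(subsetP N'sub); rewrite in_setU1 => /orP[/eqP->|]; last first.
    by apply: ord; apply: (subsetP J'J).
  have jJ := subsetP J'J _ jJ'; rewrite ltn_neqAle (dmax j jJ) andbT.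
  apply: contraNneq dJ' => jd; suff <- : j = d by [].
  by apply: (index_inj d _ _ jd); rewrite sV (subsetP JV).
have J'0 : J' != set0 by apply/set0Pn; exists x.
have vN' : v \notin nbr e J'.
  apply/negP => vN'; have : v \in N' by rewrite inE vV.
  move/(subsetP N'sub); rewrite in_setU1 (negbTE vY) orbF => /eqP vd.
  by rewrite vd dJ in vJ.
(* At least three by [sep3], as [v] lies on the other side; at most three by the width, as [N']
   comes after [J'] in the ordering. *)
have N'3 : #|N'| = 3.
  apply/eqP; rewrite eqn_leq (sepv J') // andbT.
  apply: (width_later es us el cJ' J'0) => //; last exact: subsetIr.
  - by move=> z zJ'; rewrite sV (subsetP JV) // (subsetP J'J).
  - by move=> z; rewrite sV => /setIP[].
have dN' : d \in N'.
  rewrite inE (subsetP JV) //=; case: (cJ J') => // [|p [q [pJ' /setDP[qJ qJ'] epq]]].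
    by apply: contraNneq dJ' => ->.
  have [<-|qd] := eqVneq q d; first by apply/nbrP; split=> //; exists p.
  by case/negP: qJ'; apply: clJ' epq; rewrite // !inE qd.
have dY : d \notin Y by rewrite !inE dJ /= andbF.
have N'dY : N' :\ d \subset Y.
  apply/subsetP => z /setD1P[zd /(subsetP N'sub)]; by rewrite in_setU1 (negbTE zd).
have N'd2 : #|N' :\ d| == 2 by move/eqP: N'3; rewrite (cardsD1 d) dN' add1n eqSS.
(* [J'] sees [d] and two vertices [a], [b] of [Y]; [c] is the vertex of [Y] that it misses. *)
have /cards1P[c Yc] : #|Y :\: (N' :\ d)| == 1 by rewrite cardsDS // Y3 (eqP N'd2).
have /setDP[cY cN'd] : c \in Y :\: (N' :\ d) by rewrite Yc set11.
have cV : c \in V by case/setIP: cY.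
have cJ0 : c \notin J by case/setIP: cY => _ /nbrP[].
have cd : c != d by apply: contraNneq cJ0 => ->.
have cN' : c \notin nbr e J'.
  by apply: contra cN'd => cN'; rewrite in_setD1 cd in_setI cV.
have /cards2P[a [b [ab N'ab]]] := N'd2.
have YE : Y = [set a; b; c].
  apply/setP => z; rewrite -N'ab -Yc in_setU.
  have [zN|zN] := boolP (z \in N' :\ d); first by rewrite (subsetP N'dY).
  by rewrite [in RHS]in_setD zN.
have inN' y : y \in [set a; b] -> [/\ y \in V, y \in nbr e J', y \notin J, y != d & y != c].
  rewrite -N'ab => yN; have yY := subsetP N'dY _ yN.
  case/setD1P: yN => yd /setIP[yV yJ']; split=> //; first by case/setIP: yY => _ /nbrP[].
  by apply: contraNneq cN' => <-.
have [aV aJ' aJ ad ac] := inN' a (set21 a b).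
have [bV bJ' bJ bd bc] := inN' b (set22 a b).
pose R := J :\: J'.
have cR : conn e R by apply: conn_setD cJ dJ dJ' clJ'.
have JE : J = J' :|: R.
  apply/setP => z; rewrite in_setU in_setD.
  by case: (boolP (z \in J')) => [/(subsetP J'J)->|].
have RJ z : z \notin J -> z \notin R by apply: contra => /setDP[].
have cRn : c \in nbr e R.
  case/setIP: cY => _ /nbrP[_ [p]]; rewrite {1}JE in_setU => /orP[pJ'|pR] epc.
    case/negP: cN'; apply/nbrP; split; first by apply: contra cJ0; apply: (subsetP J'J).
    by exists p.
  by apply/nbrP; split; [exact: RJ | exists p].
(* If the rest [R] of [J] sees [a] or [b] besides [c], contracting [J'] and [R] suffices; [d] in [R]
   is the vertex seen by [J']. *)
have two a' b' : a' \in [set a; b] -> b' \in [set a; b] -> Y = [set a'; b'; c] ->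
    b' \in nbr e R -> completes V e J Y.
  move=> /inN'[a'V a'J' a'J _ a'c] /inN'[b'V b'J' _ _ _] -> b'R; rewrite JE.
  apply: completes_two => //.
  - exact: subset_trans JV.
  - exact: subset_trans (subsetDl _ _) JV.
  - by rewrite disjoint_sym disjoints_subset; apply/subsetP => z /setDP[_]; rewrite inE.
  - by rewrite in_setD a'V RJ.
  - by rewrite in_setD cV andbT; apply: contra cJ0; apply: (subsetP J'J).
  - apply/orP; right; apply/exists_inP; exists d; first by rewrite in_setD dJ' dJ.
    by case/setIP: dN'.
have [bR|bR] := boolP (b \in nbr e R); first by apply: (two a b) => //; rewrite !inE eqxx ?orbT.
have [aR|aR] := boolP (a \in nbr e R).
  by apply: (two b a) => //; rewrite ?inE ?eqxx ?orbT // [[set b; a]]setUC.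
have onlyc z p : z \in V -> z \notin J -> p \in R -> e p z -> z = c.
  move=> zV zJ pR epz; have /setDP[pJ _] := pR; have zY : z \in Y by apply: (nJ z p).
  have zR : z \in nbr e R by apply/nbrP; split; [exact: RJ | exists p].
  move: zY; rewrite YE !inE => /orP[/orP[]|] /eqP // zE; subst z.
    by rewrite zR in aR.
  by rewrite zR in bR.
have vc : v != c by apply: contraNneq vY => ->.
have vd : v != d by apply: contraNneq vJ => ->.
(* Otherwise [d] and [c] alone would separate [R - d] from [v]. *)
have RE : R = [set d].
  apply/eqP/negPn/negP => Rd; have dR : d \in R by rewrite in_setD dJ' dJ.
  have [r rR _] := conn_out cR dR Rd.
  have sub : V :&: nbr e (R :\ d) \subset [set d; c].
    apply/subsetP => z /setIP[zV /nbrP[zR [p /setD1P[pd pR] epz]]]; rewrite in_set2.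
    have [//|zd] := eqVneq z d; have [zJ|zJ] := boolP (z \in J); last by rewrite (onlyc z p) ?eqxx ?orbT.
    have /setDP[pJ pJ'] := pR.
    have zJ' : z \in J' by move: zR; rewrite in_setD1 zd in_setD zJ /= andbT negbK.
    case/negP: pJ'; apply: (clJ' z) => //; first by rewrite in_setD1 pd.
    by rewrite es.
  have : 2 < #|V :&: nbr e (R :\ d)|.
    apply: sepv; first by apply: subset_trans (subD1set _ _) (subsetDl _ _).
      by apply/set0Pn; exists r.
    by apply/negP => vR; have := subsetP sub v; rewrite inE vV vR !inE (negbTE vd) (negbTE vc) => /(_ isT).
  move/leq_trans/(_ (subset_leq_card sub)); by rewrite cards2; case: (d != c).
have edc : e d c by move: cRn; rewrite RE => /nbrP[_ [_ /set1P->]].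
have JdJ' : J = d |: J' by rewrite JE RE setUC.
have ltJ : #|J'| < n by apply: leq_trans Jn; rewrite JdJ' cardsU1 dJ'.
have vJ' : v \notin J' by apply: contra vJ; apply: (subsetP J'J).
case: (IH J' ltJ v (subset_trans J'J JV) J'0 cJ' N'3 vV vJ' vN' ord') => [[l J'l]|].
  (* If [J'] were a single vertex [l], then [d] would have no neighbours but [l] and [c], against
     [sep3]. *)
  have sub : V :&: nbr e [set d] \subset [set l; c].
    apply/subsetP => z /setIP[zV /nbrP[zd [_ /set1P-> edz]]]; rewrite in_set2.
    have [zJ|zJ] := boolP (z \in J); last by rewrite (onlyc z d) ?eqxx ?orbT // RE set11.
    by move: zJ; rewrite JdJ' J'l in_setU (negbTE zd) /= => /set1P->; rewrite eqxx.
  have : 2 < #|V :&: nbr e [set d]|.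
    apply: sepv; first by rewrite sub1set.
      by apply/set0Pn; exists d; rewrite set11.
    apply/negP => vR; have := subsetP sub v; rewrite inE vV vR !inE (negbTE vc) orbF => /(_ isT) /eqP vl.
    by case/negP: vJ'; rewrite J'l vl set11.
  move/leq_trans/(_ (subset_leq_card sub)); by rewrite cards2; case: (l != c).
have N'E : V :&: nbr e J' = [set d; a; b].
  by rewrite -setUA -N'ab setD1K.
rewrite N'E YE JdJ'; apply: completes_trans => //.
- exact: subset_trans JV.
- exact: (subsetP JV).
- by apply: contra cJ0; apply: (subsetP J'J).
Qed.

(** * Adding edges at a vertex *)

(** Orderings of [V] are tuples of length [#|V|], so a finite search decides; this permits arguing
    from a counterexample. *)
Lemma tw3_decidable (T : finType) (V : {set T}) (e : rel T) : decidable (tw3 V e).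
Proof.
apply: (@decP _ [exists s : #|V|.-tuple T,
  [&& uniq s, [forall x, (x \in s) == (x \in V)] & eliminable e s]]).
apply: (iffP existsP) => [[s /and3P[us /forallP sV el]]|[s [us sV el]]].
  by exists s; split=> // x; apply/eqP.
have sz : size s == #|V| by rewrite -(card_uniqP us); apply/eqP/eq_card.
by exists (Tuple sz); rewrite us el andbT; apply/forallP => x; rewrite sV.
Qed.

Lemma add_edges_at_sym (T : finType) (e : rel T) (w : T) (S : {set T}) :
  symmetric e -> symmetric (add_edges_at e w S).
Proof.
by move=> es x y; rewrite /add_edges_at /= es; congr (_ || _); rewrite orbC.
Qed.

Lemma sub_add_edges_at (T : finType) (e : rel T) (w : T) (S : {set T}) (x y : T) :
  e x y -> add_edges_at e w S x y.
Proof. by rewrite /add_edges_at /= => ->. Qed.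

Lemma add_edges_at_far (T : finType) (e : rel T) (w : T) (S : {set T}) (x y : T) :
  x != w -> y != w -> add_edges_at e w S x y = e x y.
Proof. by rewrite /add_edges_at /= => /negbTE-> /negbTE->; rewrite !orbF. Qed.

Definition pair_extends (T : finType) (w u v : T) (V : {set T}) (e : rel T) : Prop :=
  symmetric e -> sep3 V e -> w \in V -> u \in V -> v \in V ->
  tw3 V (add_edges_at e w [set u]) -> tw3 V (add_edges_at e w [set v]) ->
  tw3 V (add_edges_at e w [set u; v]).

(** Eliminate [J] first, as in the ordering for [wu], then follow an ordering of the smaller graph
    in which [J] has become a clique on its boundary. *)
Lemma tw3_reduce (T : finType) (V : {set T}) (e : rel T) (w u v : T) (s : seq T) (J : {set T}) :
  symmetric e -> sep3 V e ->
  (forall (V' : {set T}) (e' : rel T), #|V'| < #|V| -> pair_extends w u v V' e') ->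
  w \in V -> u \in V -> v \in V -> w \notin J -> v \notin J -> J \subset V -> J != set0 ->
  uniq s -> s =i V -> eliminable (add_edges_at e w [set u]) s ->
  tw3 V (add_edges_at e w [set v]) ->
  V :&: nbr (add_edges_at e w [set u]) J = V :&: nbr e J ->
  (forall j y, j \in J -> y \in V :&: nbr e J -> index j s < index y s) ->
  completes V e J (V :&: nbr e J) ->
  tw3 V (add_edges_at e w [set u; v]).
Proof.
move=> es sp IH wV uV vV wJ vJ JV J0 us sV el twv N1 ord cmp.
set Y := V :&: nbr e J in N1 ord cmp.
set e' := add_clique Y e; set V' := V :\: J.
have red S : tw3 V (add_edges_at e w S) -> tw3 V' (add_edges_at e' w S).
  move=> tw; apply: tw3_mono (cmp _ (add_edges_at_sym w S es) _ tw).
    move=> x y _ _ _; rewrite /add_edges_at /e' /=.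
    by case/or3P=> [/orP[->|->]|->|->]; rewrite ?orbT.
  by move=> x y; apply: sub_add_edges_at.
have twv' := red _ twv.
have [s' [us' s'V el']] : tw3 V' (add_edges_at e' w [set u; v]).
  (* If [u] is in [J], the edge [wu] disappears with [J] and an ordering for [wv] is enough. *)
  have [uJ|uJ] := boolP (u \in J).
    apply: tw3_mono twv' => x y /setDP[_ xJ] /setDP[_ yJ] _.
    rewrite /add_edges_at /= !inE.
    have nu z : z \notin J -> (z == u) = false by move=> zJ; apply: contraNF zJ => /eqP->.
    by rewrite !nu.
  apply: IH => //; rewrite ?in_setD ?wJ ?uJ ?vJ //.
  - apply: proper_card; rewrite properEneq subsetDl andbT; apply: contraNneq J0 => VE.
    apply/eqP/setP => z; rewrite inE; apply/negP => zJ.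
    by have := subsetP JV _ zJ; rewrite -VE in_setD zJ.
  - exact: add_clique_sym.
  - exact: sep3_reduce.
  - by apply: red; exists s.
exists ([seq x <- s | x \in J] ++ s'); split.
- rewrite cat_uniq filter_uniq // us' andbT; apply/hasPn => z; rewrite s'V => /setDP[_ zJ].
  by rewrite mem_filter (negbTE zJ).
- move=> z; rewrite mem_cat mem_filter sV s'V in_setD.
  by case: (boolP (z \in J)) => [/(subsetP JV)->|].
apply: (eliminable_glue (Y := Y) _ us us' el el').
- exact: add_edges_at_sym.
- by move=> z; rewrite s'V => /setDP[].
- move=> j _ jJ y yY; rewrite ord // andbT sV; by case/setIP: yY.
(* Neither [w] nor [v] lies in [J], so an edge at [J] belongs to [e] plus [wu] already. *)
- move=> x y xs xJ; rewrite mem_cat sV s'V => ys xy gxy.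
  have yV : y \in V by case/orP: ys => // /setDP[].
  have e1xy : add_edges_at e w [set u] x y.
    move: gxy; rewrite /add_edges_at /= !inE.
    have -> : (x == w) = false by apply: contraNF wJ => /eqP<-.
    have -> : (x == v) = false by apply: contraNF vJ => /eqP<-.
    by rewrite orbF.
  split=> //; rewrite in_setU -N1 in_setI yV /=; have [//|yJ] := boolP (y \in J).
  by apply/nbrP; split=> //; exists x.
- move=> x y _ _ _; rewrite /add_edges_at /e' /=.
  by case/or3P=> [->|->|->]; rewrite ?orbT.
- by move=> x y xY yY _ _ _; rewrite /add_edges_at /e' /= xY yY !orbT.
Qed.

(* In a minimal counterexample, the separation of [w] from [v] by an ordering for
   [e + wu] shows that [u], but not [v], has a common neighbour with [w]. *)
Lemma common_neighbors_at (T : finType) (V : {set T}) (e : rel T) (w u v : T) :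
  symmetric e -> sep3 V e ->
  (forall (V' : {set T}) (e' : rel T), #|V'| < #|V| -> pair_extends w u v V' e') ->
  w \in V -> u \in V -> v \in V -> u != w -> v != w -> ~~ e w u ->
  tw3 V (add_edges_at e w [set u]) -> tw3 V (add_edges_at e w [set v]) ->
  ~ tw3 V (add_edges_at e w [set u; v]) ->
  (exists l, [/\ l \in V, e w l & e l u]) /\ (forall l, l \in V -> e w l -> ~~ e l v).
Proof.
move=> es sp IH wV uV vV uw vw nwu [t [ut tV elt]] twv ntw.
set e1 := add_edges_at e w [set u] in elt *.
have e1s : symmetric e1 by apply: add_edges_at_sym.
have ee1 x y : e x y -> e1 x y by apply: sub_add_edges_at.
have e1far x y : x != w -> y != w -> e1 x y = e x y by apply: add_edges_at_far.
case: (@eliminable_reroot _ e1 t [set v] e1s ut elt).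
- by move=> z /set1P->; rewrite tV.
- by move=> x y /set1P-> /set1P->; rewrite eqxx.
move=> s0 [q [us sV' qv el]].
have vq : v \in q by rewrite qv set11.
have sV : s0 ++ q =i V by move=> z; rewrite sV' tV.
have ws0 : w \in s0.
  by move: wV; rewrite -sV mem_cat qv inE [w == v]eq_sym (negbTE vw) orbF.
case/splitPr: ws0 us sV el => s1 s2 {t ut tV elt sV'}; rewrite -catA cat_cons => us sV el.
set r := s2 ++ q in us sV el; have vr : v \in r by rewrite mem_cat vq orbT.
set s := s1 ++ w :: r in us sV el.
pose B := [set x in w :: s1].
have wB : w \in B by rewrite inE mem_head.
have sE : s = s1 ++ w :: r by [].
have := us; rewrite sE cat_uniq /= => /and4P[us1 /norP[ws1 /hasPn hr] wr ur].
have iw : index w s = size s1 by rewrite sE index_cat (negbTE ws1) /= eqxx addn0.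
have iB z : z \in V -> z \notin B -> index w s < index z s.
  rewrite -sV sE mem_cat !inE negb_or iw => _ /andP[zw zs1].
  by rewrite index_cat (negbTE zs1) /= eq_sym (negbTE zw) addnS ltnS leq_addr.
have iB' z : z \in B -> z != w -> index z s < index w s.
  rewrite !inE => /orP[->//|zs1] _; by rewrite iw sE index_cat zs1 index_mem.
have vB : v \notin B.
  rewrite !inE negb_or vw /=; exact: (hr v vr).
have BV : B \subset V.
  apply/subsetP => z; rewrite -sV sE mem_cat !inE => /orP[/eqP->|->//]; by rewrite eqxx orbT.
have [A [AB wA cA clA]] := conn_min e1s wB.
have AV := subset_trans AB BV.
pose X := V :&: nbr e1 A.
have XB z : z \in X -> z \notin B.
  case/setIP => _ /nbrP[zA [p pA epz]]; apply: contra zA => zB; exact: clA epz.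
have A0 : A != set0 by apply/set0Pn; exists w.
have X3 : #|X| <= 3.
  apply: (width_later e1s us el cA A0); last 2 first.
  - exact: subsetIr.
  - move=> j z jA zX; have zV : z \in V by case/setIP: zX.
    have [->|jw] := eqVneq j w; first by rewrite iB // XB.
    by apply: ltn_trans (iB' _ (subsetP AB _ jA) jw) (iB _ zV (XB _ zX)).
  - by move=> z /(subsetP AV); rewrite -sV.
  - by move=> z /setIP[]; rewrite -sV.
have AsubL : {subset A <= w :: s1} by move=> z /(subsetP AB); rewrite inE.
(* Otherwise the ordering at hand admits [wv] by [eliminable_add_edge]. *)
have vA1 : v \notin nbr e1 A.
  apply/negP => vA1; case: ntw; exists s; split=> //.
  apply: eliminable_mono (eliminable_add_edge e1s us el cA wA AsubL vr vA1) => // x y _ _ _.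
  rewrite /add_edges_at /e1 /add_edges_at /= !inE.
  by case/or3P=> [->|/andP[->] /orP[]->|/andP[->] /orP[]->]; rewrite ?orbT.
have vA : v \notin A by apply: contra vB; apply: (subsetP AB).
have vAe : v \notin nbr e A by apply: contra vA1; apply/subsetP/nbr_mono.
have vX : v \notin X by rewrite inE negb_and vA1 orbT.
(* [sep3] gives at least three vertices on the left and the width at most three on the right, so
   [wu] does not enlarge the boundary of [A]. *)
have XE : V :&: nbr e A = X.
  apply/eqP; rewrite eqEcard setIS ?nbr_mono //=; exact: leq_trans X3 (sp A v _ _ _ _ _).
have {}X3 : #|X| = 3 by apply/eqP; rewrite eqn_leq X3 -XE (sp A v).
have wX : w \notin X by rewrite inE inE wA andbF.
have XA z : z \in X -> z \notin A by case/setIP => _ /nbrP[].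
have outA z p : z \in V -> p \in A -> e1 p z -> z \notin A -> z \in X.
  by move=> zV pA epz zA; rewrite inE zV; apply/nbrP; split=> //; exists p.
have e1w : e1 w u by rewrite /e1 /add_edges_at /= !inE !eqxx orbT.
have JV (J : {set T}) : J \subset A :\ w -> J \subset V.
  by move=> JA; apply: subset_trans JA (subset_trans (subD1set _ _) AV).
have JA (J : {set T}) z : J \subset A :\ w -> z \in J -> z \in A /\ z != w.
  by move=> JA /(subsetP JA) /setD1P[].
have JwX (J : {set T}) z : J \subset A :\ w -> z \in w |: X -> z \notin J.
  move=> JAw; rewrite in_setU1 => zwX; apply/negP => /(JA J z JAw)[zA zw].
  by move: zwX; rewrite (negbTE zw) /= => /XA; rewrite zA.
have N1E (J : {set T}) : J \subset A :\ w -> w \in nbr e J -> V :&: nbr e1 J = V :&: nbr e J.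
  move=> JAw wJ; apply/eqP; rewrite eqEsubset andbC setIS ?nbr_mono //=.
  apply/subsetP => z /setIP[zV /nbrP[zJ [p pJ epz]]]; rewrite inE zV /=.
  have [->//|zw] := eqVneq z w; have [_ pw] := JA _ _ JAw pJ.
  by apply/nbrP; split=> //; exists p; rewrite // -e1far.
have ordJ (J : {set T}) j y : J \subset A :\ w -> j \in J -> y \in w |: X -> index j s < index y s.
  move=> JAw jJ; have [jA jw] := JA _ _ JAw jJ; have lt := iB' _ (subsetP AB _ jA) jw.
  rewrite in_setU1 => /orP[/eqP->//|yX]; apply: ltn_trans lt (iB _ _ (XB _ yX)).
  by case/setIP: yX.
have nocomp (J : {set T}) : J \subset A :\ w -> J != set0 -> w \in nbr e J ->
    V :&: nbr e J \subset w |: X -> ~ completes V e J (V :&: nbr e J).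
  move=> JAw J0 wJ NJ cmp; apply: ntw.
  apply: (tw3_reduce es sp IH wV uV vV _ _ (JV _ JAw) J0 us sV el twv (N1E _ JAw wJ) _ cmp).
  - by apply/negP => /(JA _ _ JAw)[_]; rewrite eqxx.
  - by apply: contra vA => /(JA _ _ JAw)[].
  - by move=> j y jJ /(subsetP NJ); apply: ordJ jJ.
have el0 : eliminable e s by apply: eliminable_mono el => // x y _ _ _; apply: ee1.
have nvN (J : {set T}) : J \subset A -> v \notin nbr e J.
  move=> JAs; apply/negP => /nbrP[vJ [p pJ epv]]; case/negP: vAe; apply/nbrP; split=> //.
  by exists p => //; apply: (subsetP JAs).
(* The component [J] of [l] in [A - w] has exactly three neighbours, [w] among them. Since it cannot
   be completed, [rooted_triangle] leaves only [J] equal to [l] alone. *)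
have leaf l : l \in A :\ w -> let Y := V :&: nbr e [set l] in
    [/\ #|Y| = 3, Y \subset w |: X & w \in Y].
  move=> lA Y; have [J [JAw lJ cJ clJ]] := conn_min es lA.
  have J0 : J != set0 by apply/set0Pn; exists l.
  have JsA : J \subset A by apply: subset_trans JAw (subD1set _ _).
  have NJ : V :&: nbr e1 J \subset w |: X.
    apply/subsetP => z /setIP[zV /nbrP[zJ [p pJ epz]]]; rewrite in_setU1.
    have [//|zw] := eqVneq z w; have [pA pw] := JA _ _ JAw pJ.
    have [zA|zA] := boolP (z \in A); last exact: outA epz zA.
    by case/negP: zJ; apply: (clJ p); rewrite -?e1far // in_setD1 zw.
  have NsubN : V :&: nbr e J \subset V :&: nbr e1 J by rewrite setIS ?nbr_mono.
  have N3 : 2 < #|V :&: nbr e J|.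
    apply: (sp J v) => //; [exact: JV | | exact: nvN].
    by apply: contra vA; apply: (subsetP JsA).
  have N13 : #|V :&: nbr e1 J| <= 3.
    apply: (width_later e1s us el _ J0); last 2 first.
    - exact: subsetIr.
    - move=> j z jJ /(subsetP NJ); exact: ordJ jJ.
    - by apply: conn_mono cJ => x y _ _; apply: ee1.
    - by move=> z /(subsetP (JV _ JAw)); rewrite sV.
    - by move=> z /setIP[]; rewrite sV.
  have N1 : V :&: nbr e J = V :&: nbr e1 J.
    by apply/eqP; rewrite eqEcard NsubN; exact: leq_trans N13 N3.
  (* As [A] is connected, some edge within [A] leaves [J], and it can only end in [w]. *)
  have wJ : w \in V :&: nbr e J.
    have JnA : J != A.
      by apply/eqP => JE; have [] := JA _ w JAw; rewrite ?JE // eqxx.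
    rewrite N1; have [p [z [pJ /setDP[zA zJ] epz]]] := cA J JsA J0 JnA.
    have [<-|zw] := eqVneq z w; first by rewrite inE (subsetP AV) //; apply/nbrP; split=> //; exists p.
    have [_ pw] := JA _ _ JAw pJ.
    by case/negP: zJ; apply: (clJ p); rewrite -?e1far // in_setD1 zw.
  rewrite -N1 in NJ.
  have {}N3 : #|V :&: nbr e J| = 3 by apply/eqP; rewrite eqn_leq N3 N1 N13.
  have vJ : v \notin J by apply: contra vA; apply: (subsetP JsA).
  have oJ j y : j \in J -> y \in V :&: nbr e J -> index j s < index y s.
    by move=> jJ /(subsetP NJ); apply: ordJ jJ.
  have [[l' J']|cmp] := rooted_triangle es sp us sV el0 (JV _ JAw) J0 cJ N3 vV vJ (nvN _ JsA) oJ.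
    by move: lJ N3 NJ wJ; rewrite /Y J' => /set1P<-.
  by case: (nocomp J JAw J0 _ NJ cmp); case/setIP: wJ.
have AwN l z : l \in A :\ w -> z \in V :&: nbr e [set l] -> e l z.
  by move=> _ /setIP[_ /nbrP[_ [_ /set1P->]]].
have Aw1 l : l \in A :\ w -> [set l] \subset A :\ w by rewrite sub1set.
have n1 (x : T) : [set x] != set0 by apply/set0Pn; exists x; rewrite set11.
(* Two adjacent neighbours of [l] would make [completes_leaf] applicable. *)
have indep l x y : l \in A :\ w -> x \in V :&: nbr e [set l] -> y \in V :&: nbr e [set l] ->
    x != y -> ~~ e x y.
  move=> lA; have [Y3 YX wY] := leaf l lA; set Y := _ :&: _ in Y3 YX wY *.
  move=> xY yY xy; apply/negP => exy.
  have lV : l \in V by apply: (subsetP (JV _ (Aw1 _ lA))); rewrite set11.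
  have nl z : z \in Y -> z != l by case/setIP => _ /nbrP[]; rewrite inE.
  have /cards1P[c Yc] : #|Y :\: [set x; y]| == 1.
    rewrite cardsDS ?Y3 ?cards2 ?xy //; by apply/subsetP => z /set2P[]->.
  have /setDP[cY _] : c \in Y :\: [set x; y] by rewrite Yc set11.
  have YE : Y = [set x; y; c].
    apply/setP => z; rewrite -Yc in_setU in_setD.
    by case: (boolP (z \in [set x; y])) => [/set2P[]->|].
  case: (nocomp [set l]) => //; [exact: Aw1 | by case/setIP: wY | rewrite -/Y YE].
  by apply: completes_leaf; rewrite ?nl ?(AwN l) //; case/setIP: cY.
(* Two such vertices with the same three neighbours could be contracted into two of these, giving a
   triangle. *)
have distinct l l' : l \in A :\ w -> l' \in A :\ w -> l != l' ->
    V :&: nbr e [set l] != V :&: nbr e [set l'].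
  move=> lA lA' ll'; apply/eqP => YY.
  have [Y3 YX wY] := leaf l lA; set Y := _ :&: _ in Y3 YX wY YY.
  have JAw : [set l] :|: [set l'] \subset A :\ w by rewrite subUset !Aw1.
  have NE : V :&: nbr e ([set l] :|: [set l']) = Y.
    apply/setP => z; apply/idP/idP => [/setIP[zV /nbrP[]]|zY].
      rewrite in_setU negb_or => /andP[zl zl'] [y + eyz]; rewrite in_setU => /orP[] /set1P yl.
        by rewrite inE zV; apply/nbrP; split=> //; exists y; rewrite // yl set11.
      by rewrite YY inE zV; apply/nbrP; split=> //; exists y; rewrite // yl set11.
    have zV : z \in V by case/setIP: zY.
    rewrite inE zV; apply/nbrP; split; first by apply: JwX JAw _; apply: (subsetP YX).
    by exists l; rewrite ?inE ?eqxx // (AwN l).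
  have [a [b [c [YE ab bc ac]]]] := cards3_set Y3.
  have [aY bY cY] : [/\ a \in Y, b \in Y & c \in Y] by rewrite YE !inE !eqxx !orbT.
  have nY z : z \in Y -> z \in nbr e [set l] /\ z \in nbr e [set l'].
    by move=> zY; split; [case/setIP: zY | move: zY; rewrite YY => /setIP[]].
  have Yl z : z \in Y -> z \in V by case/setIP.
  have Vl z : z \in A :\ w -> [set z] \subset V by move=> zA; apply: JV; apply: Aw1.
  case: (nocomp _ JAw); rewrite ?NE //.
  - by apply/set0Pn; exists l; rewrite !inE eqxx.
  - by have := wY; rewrite -NE => /setIP[].
  have [al al'] := nY _ aY; have [bl bl'] := nY _ bY; have [cl cl'] := nY _ cY.
  rewrite YE; apply: completes_two => //.
  - exact: Vl.
  - exact: Vl.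
  - by rewrite disjoints1 inE.
  - exact: conn1.
  - exact: conn1.
  - by rewrite in_setD Yl // andbT; case/nbrP: al'.
  - exact: Yl.
  - by rewrite in_setD Yl // andbT; case/nbrP: cl.
  - by rewrite cl.
(* If [u] were in [A], it would be adjacent to [w] by [leaf]. *)
have uX : u \in X.
  have [uA|uA] := boolP (u \in A); last exact: outA e1w uA.
  have uAw : u \in A :\ w by rewrite in_setD1 uw.
  have [_ _ wu] := leaf u uAw; by case/negP: nwu; rewrite es (AwN u).
have Nw z : z \in V :&: nbr e [set w] -> z \in A :\ w \/ z \in X.
  case/setIP => zV /nbrP[zw [_ /set1P-> ewz]]; rewrite inE in zw.
  have [zA|zA] := boolP (z \in A); first by left; rewrite in_setD1 zw.
  by right; apply: outA wA (ee1 _ _ ewz) zA.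
have Nw3 : 2 < #|V :&: nbr e [set w]|.
  apply: (sp [set w] v) => //; [by rewrite sub1set | by rewrite inE | by apply: nvN; rewrite sub1set].
(* If each vertex of [X] has a neighbour in [A - w], then [indep] forbids edges from [w] to [X]. So
   the neighbours of [w] lie in [A - w], and they see only [w] and [X], hence not [v]. *)
have conclude : (forall z, z \in X -> exists2 l, l \in A :\ w & z \in V :&: nbr e [set l]) ->
    (exists l, [/\ l \in V, e w l & e l u]) /\ (forall l, l \in V -> e w l -> ~~ e l v).
  move=> cover; split.
    have [l lA ul] := cover u uX; have [_ _ wl] := leaf l lA.
    exists l; rewrite es !(AwN l) //; split=> //; apply: (subsetP (JV _ (Aw1 _ lA))).
    by rewrite set11.
  move=> l lV ewl; apply/negP => elv.
  have [lw|lw] := eqVneq l w.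
    subst l; have := nvN [set w]; rewrite sub1set => /(_ wA) /negP; apply.
    by apply/nbrP; rewrite inE vw; split=> //; exists w; rewrite ?set11.
  case: (Nw l); first by rewrite inE lV; apply/nbrP; rewrite inE lw; split=> //; exists w; rewrite ?set11.
    move=> lA; have [_ YX _] := leaf l lA.
    have : v \in w |: X.
      apply: (subsetP YX); rewrite inE vV; apply/nbrP; split; last by exists l; rewrite ?set11.
      by rewrite inE; apply: contraNneq vA => ->; case/setD1P: lA.
    by rewrite in_setU1 (negbTE vw) (negbTE vX).
  move=> lX; have [l' lA' ll'] := cover l lX; have [_ _ wl'] := leaf l' lA'.
  have := indep l' w l lA' wl' ll'; by rewrite eq_sym lw ewl => /(_ isT).
(* Two distinct neighbourhoods [w + two vertices of X] cover [X]; with at most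
   one vertex in [A - w] the degree of [w] would be at most 2. *)
have [/card_gt1P[l [l' [lA lA' ll']]]|small] := ltnP 1 #|A :\ w|.
  apply: conclude => z zX.
  (* A vertex of [A - w] that misses [z] is determined up to its neighbourhood, which is [w] and the
     rest of [X]; by [distinct] this happens at most once. *)
  have YE t : t \in A :\ w -> z \notin V :&: nbr e [set t] -> V :&: nbr e [set t] = w |: (X :\ z).
    move=> tA zt; have [Y3 YX wY] := leaf t tA; apply/eqP; rewrite eqEcard Y3.
    have -> : #|w |: (X :\ z)| = 3.
      by rewrite cardsU1 in_setD1 (negbTE wX) andbF -X3 (cardsD1 z X) zX.
    rewrite andbT; apply/subsetP => y yY; have := subsetP YX _ yY; rewrite !in_setU1 in_setD1.
    by case/orP=> [->//|->]; rewrite andbT orbC; have [yz|//] := eqVneq y z; rewrite -yz yY in zt.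
  have [zl|zl] := boolP (z \in V :&: nbr e [set l]); first by exists l.
  have [zl'|zl'] := boolP (z \in V :&: nbr e [set l']); first by exists l'.
  by case/eqP: (distinct l l' lA lA' ll'); exact: etrans (YE l lA zl) (esym (YE l' lA' zl')).
exfalso; have [A0w|[l lA]] := set_0Vmem (A :\ w).
  have : V :&: nbr e [set w] \subset X :\ u.
    apply/subsetP => z zN; have [|zX] := Nw z zN; first by rewrite A0w inE.
    rewrite in_setD1 zX andbT; apply: contraNneq nwu => <-.
    by case/setIP: zN => _ /nbrP[_ [_ /set1P->]].
  move/subset_leq_card/(leq_trans Nw3) => lt.
  by move/eqP: X3; rewrite (cardsD1 u) uX add1n eqSS => /eqP X2; rewrite X2 in lt.
have lE : A :\ w = [set l].
  by apply/esym/eqP; rewrite eqEcard sub1set lA cards1.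
have [Y3 YX wY] := leaf l lA; set Y := _ :&: _ in Y3 YX wY.
have XY : #|X :\: Y| = 1.
  have -> : X :\: Y = X :\: (Y :\ w).
    apply/setP => z; rewrite !in_setD in_set1.
    by have [->|//] := eqVneq z w; rewrite (negbTE wX) !andbF.
  rewrite cardsDS.
    by rewrite X3; move/eqP: Y3; rewrite (cardsD1 w) wY add1n eqSS => /eqP->.
  apply/subsetP => z /setD1P[zw /(subsetP YX)]; by rewrite in_setU1 (negbTE zw).
(* By [indep], [w] is adjacent to no vertex of [X] that [l] sees, and [l] sees all but one. *)
have : V :&: nbr e [set w] \subset l |: (X :\: Y).
  apply/subsetP => z zN; rewrite in_setU1; have [|zX] := Nw z zN; first by rewrite lE inE => ->.
  rewrite in_setD zX andbT; apply/orP; right; apply/negP => zY.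
  case/setIP: zN => _ /nbrP[zw [_ /set1P-> ewz]]; rewrite inE in zw.
  by have := indep l w z lA wY zY; rewrite eq_sym zw ewz => /(_ isT).
move/subset_leq_card/(leq_trans Nw3); rewrite cardsU1 XY; by case: (l \notin _).
Qed.

(** In a smallest counterexample, [common_neighbors_at] denies that [w] and [v] have a common
    neighbour, and with [u] and [v] exchanged it provides one. *)
Lemma three_connected_pair (T : finType) (w u v : T) (V : {set T}) (e : rel T) :
  u != w -> v != w -> pair_extends w u v V e.
Proof.
move=> uw vw; have [n] := ubnP #|V|.
elim: n V e => // n IH V e; rewrite ltnS => Vn es sp wV uV vV twu twv.
have uv_mono a b : e w a -> a != w -> tw3 V (add_edges_at e w [set b]) -> tw3 V (add_edges_at e w [set a; b]).
  move=> ewa aw; apply: tw3_mono => x y _ _ _; rewrite /add_edges_at /= !inE.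
  case/or3P=> [->//|/andP[/eqP->] /orP[/eqP->|->]|/andP[/eqP->] /orP[/eqP->|->]];
    by rewrite ?eqxx ?orbT // ?ewa // es ewa.
have [ewu|nwu] := boolP (e w u); first exact: uv_mono.
have [ewv|nwv] := boolP (e w v); first by rewrite setUC; exact: uv_mono.
have IHu (V' : {set T}) (e' : rel T) : #|V'| < #|V| -> pair_extends w u v V' e'.
  by move=> V'V; apply: IH; apply: leq_trans Vn.
have IHv (V' : {set T}) (e' : rel T) : #|V'| < #|V| -> pair_extends w v u V' e'.
  by move=> V'V ? ? ? ? ? ? ?; rewrite setUC; apply: IHu.
have [//|ntw] := tw3_decidable V (add_edges_at e w [set u; v]).
have [_ noV] := common_neighbors_at es sp IHu wV uV vV uw vw nwu twu twv ntw.
have ntw' : ~ tw3 V (add_edges_at e w [set v; u]) by rewrite setUC.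
have [[l [lV ewl elv]] _] := common_neighbors_at es sp IHv wV vV uV vw uw nwv twv twu ntw'.
by have := noV l lV ewl; rewrite elv.
Qed.

(** Absorb one edge [wu] into [e]: [sep3] persists, and by the case of two edges each other [wv] can
    still be added singly. *)
Lemma three_connected_star (T : finType) (w : T) (S V : {set T}) (e : rel T) :
  symmetric e -> sep3 V e -> w \in V -> S \subset V -> w \notin S -> tw3 V e ->
  {in S, forall u, tw3 V (add_edges_at e w [set u])} ->
  tw3 V (add_edges_at e w S).
Proof.
move=> es sp wV + wS tw; move: es sp tw wS; have [n] := ubnP #|S|.
elim: n S e => // n IH S e; rewrite ltnS => Sn es sp tw wS SV twS.
have [S0|[u uS]] := set_0Vmem S.
  by apply: tw3_mono tw => x y _ _ _; rewrite S0 /add_edges_at /= !inE !andbF !orbF.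
have nw x : x \in S -> x != w by move=> xS; apply: contraNneq wS => <-.
have : tw3 V (add_edges_at (add_edges_at e w [set u]) w (S :\ u)).
  apply: IH.
  - by apply: leq_trans Sn; rewrite (cardsD1 u S) uS.
  - exact: add_edges_at_sym.
  - by apply: sep3_mono sp => x y; apply: sub_add_edges_at.
  - exact: twS.
  - by rewrite in_setD1 (negbTE wS) andbF.
  - by apply: subset_trans SV; apply: subD1set.
  move=> v /setD1P[vu vS].
  have := @three_connected_pair _ w u v V e (nw u uS) (nw v vS) es sp wV
    (subsetP SV _ uS) (subsetP SV _ vS) (twS u uS) (twS v vS).
  apply: tw3_mono => x y _ _ _; rewrite /add_edges_at /= !inE.
  by case/or3P=> [/or3P[->|/andP[->->]|/andP[->->]]|/andP[->->]|/andP[->->]]; rewrite ?orbT.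
apply: tw3_mono => x y _ _ _; rewrite /add_edges_at /= !inE.
case/or3P=> [->//|/andP[-> yS]|/andP[-> xS]].
  by have [->|_] := eqVneq y u; rewrite ?yS ?orbT.
by have [->|_] := eqVneq x u; rewrite ?xS ?orbT.
Qed.

(** * 3-trees and elimination orderings *)

Lemma three_tree_dom (T : finType) (V : {set T}) (E : rel T) :
  three_tree V E -> forall x y, E x y -> x \in V /\ y \in V.
Proof.
elim=> {V E} [V E _ EE x y|V E E' v a b c _ IH vV aV bV cV _ _ _ EE x y].
  by rewrite EE => /and3P[].
have abc z : z \in [set a; b; c] -> z \in V by move=> /setUP[/set2P[]|/set1P] ->.
rewrite EE !in_setU1 => /or3P[/IH[-> ->]|/andP[-> /abc->]|/andP[-> /abc->]]; by rewrite ?orbT.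
Qed.

Lemma three_tree_sym (T : finType) (V : {set T}) (E : rel T) :
  three_tree V E -> symmetric E.
Proof.
elim=> {V E} [V E _ EE x y|V E E' v a b c _ IH _ _ _ _ _ _ _ EE x y].
  by rewrite !EE andbCA [y == x]eq_sym.
by rewrite !EE IH; congr (_ || _); rewrite orbC.
Qed.

Lemma three_tree_irr (T : finType) (V : {set T}) (E : rel T) :
  three_tree V E -> irreflexive E.
Proof.
elim=> {V E} [V E _ EE x|V E E' v a b c _ IH vV aV bV cV _ _ _ EE x].
  by rewrite EE eqxx !andbF.
rewrite EE IH orbb; apply: contraNF vV => /andP[/eqP<-].
by move=> /setUP[/set2P[]|/set1P] ->.
Qed.

(** A clique through the newest vertex lies in that vertex together with its triangle; any other
    clique lives in the smaller 3-tree. *)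
Lemma three_tree_clique (T : finType) (V : {set T}) (E : rel T) (Q : {set T}) :
  three_tree V E -> Q \subset V -> {in Q &, forall x y, x != y -> E x y} ->
  exists K : {set T}, [/\ #|K| = 4, Q \subset K, K \subset V &
    {in K &, forall x y, x != y -> E x y}].
Proof.
move=> tt; elim: tt Q => {V E} [V E V4 EE|V E E' v a b c tt IH vV aV bV cV ab bc ac EE] Q QV QE.
  by exists V; split=> // x y xV yV xy; rewrite EE xV yV.
have Es := three_tree_sym tt.
have abcV z : z \in [set a; b; c] -> z \in V by move=> /setUP[/set2P[]|/set1P] ->.
have [vQ|vQ] := boolP (v \in Q); last first.
  have QV' : Q \subset V.
    apply/subsetP => z zQ; have := subsetP QV _ zQ; rewrite in_setU1 => /orP[/eqP zv|//].
    by rewrite -zv zQ in vQ.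
  case: (IH Q QV') => [x y xQ yQ xy|K [K4 QK KV KE]].
    have := QE _ _ xQ yQ xy; rewrite EE.
    have nv z : z \in Q -> (z == v) = false by move=> zQ; apply: contraNF vQ => /eqP<-.
    by rewrite !nv //= orbF.
  exists K; split=> //; first exact: subset_trans KV (subsetUr _ _).
  by move=> x y xK yK xy; rewrite EE KE.
exists (v |: [set a; b; c]); split.
- have nE x y : E x y -> x != y by apply: contraTneq => ->; rewrite (three_tree_irr tt).
  have vn : v \notin [set a; b; c] by apply: contra vV; apply: abcV.
  rewrite cardsU1 vn setUC cardsU1 cards2 (nE _ _ ab) !inE [c == a]eq_sym [c == b]eq_sym.
  by rewrite (negbTE (nE _ _ ac)) (negbTE (nE _ _ bc)).
- apply/subsetP => z zQ; rewrite in_setU1; have [//|zv] := eqVneq z v.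
  have := QE z v zQ vQ zv; rewrite EE (negbTE zv) eqxx /=; case/orP=> // /(three_tree_dom tt)[_].
  by rewrite (negbTE vV).
- by apply: setUS; apply/subsetP.
move=> x y; rewrite !in_setU1 EE => /orP[/eqP->|xA] /orP[/eqP->|yA]; rewrite ?eqxx //.
- by rewrite yA orbT.
- by rewrite xA !orbT.
by move=> xy; rewrite (clique3 Es ab ac bc).
Qed.

(* The four vertices [inr i] provide the initial K4, whatever the size of [T]. *)
Lemma eliminable_three_tree (T : finType) (e : rel T) (s : seq T) :
  symmetric e -> uniq s -> eliminable e s ->
  exists (V : {set T + 'I_4}) (E : rel (T + 'I_4)),
    [/\ three_tree V E, forall x, (inl x \in V) = (x \in s) &
        {in s &, forall x y, x != y -> e x y -> E (inl x) (inl y)}].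
Proof.
elim: s e => [|x s IH] e es /=.
  pose V : {set T + 'I_4} := [set inr i | i : 'I_4].
  exists V, [rel p q | [&& p \in V, q \in V & p != q]]; split=> //.
    by apply: three_tree_K4 => //; rewrite card_imset ?card_ord //; apply: inr_inj.
  by move=> x; apply/negP => /imsetP[].
case/andP=> xs us /andP[c el].
have [V [E [tt Vs Ee]]] := IH _ (fill_sym x es) us el.
pose Q : {set T + 'I_4} := [set inl y | y in [set y in s | e x y]].
have [|p q|K [K4 QK KV KE]] := three_tree_clique (Q := Q) tt.
- by apply/subsetP => _ /imsetP[y + ->]; rewrite inE Vs => /andP[].
- case/imsetP=> y + -> /imsetP[z + ->]; rewrite !inE => /andP[ys exy] /andP[zs exz] yz.
  by apply: Ee => //=; rewrite [e y x]es exy exz orbT.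
have Q3 : #|Q| <= 3 by apply: leq_trans c; apply: leq_imset_card.
(* As [Q] has at most three vertices, some [k] of the [K4] is outside it; the other three form a
   triangle containing [Q], to which [x] is attached. *)
have [k /setDP[kK kQ]] : exists k, k \in K :\: Q.
  apply/set0Pn; rewrite -card_gt0 cardsDS // K4 subn_gt0; exact: leq_trans Q3 _.
have [a [b [d [KdE ab bd ad]]]] : exists a b c, [/\ K :\ k = [set a; b; c], a != b, b != c & a != c].
  by apply: cards3_set; move/eqP: K4; rewrite (cardsD1 k) kK add1n eqSS => /eqP.
have inK z : z \in [set a; b; d] -> z \in K by rewrite -KdE => /setD1P[].
have [aK bK dK] : [/\ a \in K, b \in K & d \in K] by split; apply: inK; rewrite !inE eqxx ?orbT.
pose E' := [rel p q | [|| E p q, (p == inl x) && (q \in [set a; b; d]) | (q == inl x) && (p \in [set a; b; d])]].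
exists (inl x |: V), E'; split.
- apply: (@three_tree_add _ V E E' (inl x) a b d tt) => //; rewrite ?Vs //; try exact: (subsetP KV); exact: KE.
- by move=> y; rewrite in_setU1 Vs inE.
have inQ y : y \in s -> e x y -> inl y \in [set a; b; d].
  move=> ys exy; have yQ : inl y \in Q by apply/imsetP; exists y; rewrite ?inE ?ys.
  by rewrite -KdE in_setD1 (subsetP QK) // andbT; apply: contraNneq kQ => <-.
move=> y z; rewrite !inE => /orP[/eqP->|ys] /orP[/eqP->|zs]; rewrite ?eqxx //= => yz eyz.
- by rewrite eqxx inQ ?orbT.
- have exy : e x y by rewrite es.
  by rewrite (inQ y ys exy) eqxx !orbT.
by rewrite Ee //= eyz.
Qed.

(** Undo the construction: the newest vertex has a triangle as neighbourhood, so eliminating it adds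
    no edge between distinct vertices. *)
Lemma three_tree_eliminable (T : finType) (V : {set T}) (E : rel T) :
  three_tree V E -> tw3 V E.
Proof.
elim=> {V E} [V E V4 EE|V E E' v a b c tt [s [us sV el]] vV aV bV cV ab bc ac EE].
  exists (enum V); split; [exact: enum_uniq | exact: mem_enum |].
  by apply: eliminable_small; rewrite -cardE V4.
have Es := three_tree_sym tt.
exists (v :: s); split=> /=.
- by rewrite sV vV.
- by move=> z; rewrite in_setU1 inE sV.
have nb z : z \in s -> E' v z -> z \in [set a; b; c].
  rewrite EE eqxx /= => zs; case/or3P => [/(three_tree_dom tt)[]|//|/andP[/eqP zv]].
    by rewrite (negbTE vV).
  by rewrite zv sV (negbTE vV) in zs.
have nv z : z \in s -> (z == v) = false by rewrite sV => zV; apply: contraNF vV => /eqP<-.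
have E's : symmetric E' by move=> x y; rewrite !EE Es; congr (_ || _); rewrite orbC.
apply/andP; split.
  apply: (@leq_trans #|[set a; b; c]|).
    by apply/subset_leq_card/subsetP => z; rewrite inE => /andP[]; apply: nb.
  by rewrite setUC cardsU1 cards2; case: (_ \notin _); case: (_ != _).
apply: eliminable_mono el => // x y xs ys xy /= /orP[|/andP[vx vy]].
  by rewrite EE !nv //= orbF.
by apply: (clique3 Es ab ac bc) xy; apply: nb => //; rewrite E's.
Qed.

Lemma partial_3treeP (T : finType) (e : rel T) :
  symmetric e -> irreflexive e -> (partial_3tree e <-> tw3 [set: T] e).
Proof.
move=> es ei; split=> [[T' [V [E [f [tt fi fV fE]]]]]|[s [us sV el]]]; last first.
  have [V [E [tt Vs Ee]]] := eliminable_three_tree es us el.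
  exists _, V, E, inl; split=> //; [exact: inl_inj | by move=> x; rewrite Vs sV inE |].
  move=> x y exy; apply: Ee => //; rewrite ?sV ?inE //.
  by apply: contraTneq exy => ->; rewrite ei.
have [s [us sV el]] := three_tree_eliminable tt.
(* The partial inverse of [f] exhibits [e] as a minor with singleton branch sets. *)
pose h y := [pick x | f x == y].
have hf x : h (f x) = Some x.
  by rewrite /h; case: pickP => [z /eqP/fi->//|/(_ x)]; rewrite eqxx.
have hE y x : h y = Some x -> y = f x.
  by rewrite /h; case: pickP => // z /eqP <- [->].
have fin x : f x \in some_fiber h s x by rewrite inE sV fV hf eqxx.
exists (undup (pmap h s)); split; first exact: undup_uniq.
  move=> x; rewrite mem_undup inE mem_pmap -hf map_f // sV; exact: fV.
apply: (eliminable_minor (three_tree_sym tt) us el) => [p|p q _ _ _ epq].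
  have -> : some_fiber h s p = [set f p].
    apply/setP => y; apply/idP/set1P => [|->//]; by rewrite inE => /andP[_ /eqP/hE].
  exact: conn1.
by exists (f p), (f q); rewrite !fin fE.
Qed.

(** * From vertex cuts to neighbourhoods, and the final assembly *)

(** A path that starts in [A] and avoids the neighbourhood of [A] never leaves [A], so deleting this
    neighbourhood separates [A] from [v]. *)
Lemma three_connected_sep3 (T : finType) (e : rel T) :
  three_connected e -> sep3 [set: T] e.
Proof.
move=> [_ sep] A v _ /set0Pn[a aA] _ vA vN; rewrite setTI; apply: sep => con.
have aN : a \notin nbr e A by rewrite inE aA.
have /connectP[p] := con a v aN vN; elim: p a aA aN => [|y p IH] a aA aN /=.
  by move=> _ va; rewrite va aA in vA.
case/andP=> /and3P[eay _ yN] py vl; apply: (IH y) => //.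
by apply: contraNT yN => yA; apply/nbrP; split=> //; exists a.
Qed.

Theorem mainTheorem4 (T : finType) (e : rel T) (w : T) (S : {set T}) :
  simple_graph e ->
  three_connected e ->
  partial_3tree e ->
  (forall u, u \in S -> u != w /\ ~~ e w u) ->
  (forall u, u \in S -> partial_3tree (add_edges_at e w [set u])) ->
  partial_3tree (add_edges_at e w S).
Proof.
move=> [es ei] /three_connected_sep3 sp pe Sw pS.
have wS : w \notin S by apply/negP => /Sw[]; rewrite eqxx.
have irr (S' : {set T}) : w \notin S' -> irreflexive (add_edges_at e w S').
  move=> wS' x; rewrite /add_edges_at /= ei orbb; apply/negP => /andP[/eqP->].
  by rewrite (negbTE wS').
apply/(partial_3treeP (add_edges_at_sym _ _ es) (irr _ wS)).
apply: three_connected_star; rewrite ?inE //; first by apply/partial_3treeP.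
move=> u uS; apply/partial_3treeP; [exact: add_edges_at_sym | | exact: pS].
by apply: irr; rewrite inE eq_sym; case: (Sw u uS).
Qed.
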